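(* Fix an integer $g\ge2$. There exist constants $c>0$ and $C>0$, depending only on $g$, such that for every real $x\ge1$, \[ \sum_{\substack{m,n\in\mathscr{P}^{\ast}(x)\\ \gcd(m,n)=1}} 1 = \frac{1}{\zeta(2)}\prod_{p\mid g^{3}-g}\Bigl(1-\frac{1}{p^{2}}\Bigr)^{-1} \#\mathscr{P}^{\ast}(x)^{2}\,\bigl(1+E(x)\bigr) \quad\text{with}\quad |E(x)|\le C e^{-c\sqrt{\log x}}, \] where the product is over primes $p$ dividing $g^3-g$ and $\zeta$ is the Riemann zeta function.
   Context: Let $g\ge2$ be an integer (the base). Every positive integer $n$ has a unique base-$g$ expansion $n=\sum_{i=0}^{L-1}n_i g^i$ with $L\ge1$, digits $n_i\in\{0,\dots,g-1\}$ and $n_{L-1}\neq0$. A positive integer $n$ is a palindrome (in base $g$) if $n_i=n_{L-1-i}$ for all $0\le i\le L-1$. For real $x$, $\mathscr{P}^{\ast}(x)$ denotes the set of integers $n\in[1,x]$ that are palindromes and satisfy $\gcd(n,g^3-g)=1$; $\#$ denotes cardinality. *)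

(* Defs.v *)
From HB Require Import structures.
From mathcomp Require Import all_boot all_order all_algebra.
From mathcomp Require Import all_classical all_reals all_analysis.

Set Implicit Arguments.
Unset Strict Implicit.
Unset Printing Implicit Defensive.

Import Order.TTheory GRing.Theory Num.Theory.
Import numFieldNormedType.Exports.

Local Open Scope classical_set_scope.
Local Open Scope ring_scope.

(* Digits are listed from the least significant one; the values of [d] at
   indices >= L are irrelevant.  For 2 <= g and 0 < n, such an L exists and is
   unique, and so are the digits d 0, ..., d (L - 1). *)
Definition base_expansion (g n L : nat) (d : nat -> nat) : Prop :=
  [/\ (1 <= L)%N,
      forall i : nat, (i < L)%N -> (d i < g)%N,
      d (L - 1)%N <> 0%N
    & n = (\sum_(0 <= i < L) d i * g ^ i)%N].

Definition palindrome (g n : nat) : Prop :=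
  exists (L : nat) (d : nat -> nat),
    base_expansion g n L d /\
    forall i : nat, (i <= L - 1)%N -> d i = d (L - 1 - i)%N.

Definition Pstar (R : realType) (g : nat) (x : R) : set nat :=
  [set n | [/\ (1 <= n)%N, n%:R <= x, palindrome g n
             & gcdn n (g ^ 3 - g) = 1%N]].

(* Finiteness makes [\sum_(_ \in _)] and [fset_set] over [Pstar g x] the
   genuine sum and set of elements rather than their default values. *)
Lemma finite_Pstar (R : realType) (g : nat) (x : R) : finite_set (Pstar g x).
Proof.
apply: (@sub_finite_set _ _ `I_(Num.truncn x).+1); last exact: finite_II.
move=> n /= [_ nx _ _].
by rewrite -(ltr_nat R) (le_lt_trans nx) // truncnS_gt.
Qed.

Definition coprime_pairs (R : realType) (g : nat) (x : R) : set (nat * nat) :=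
  [set mn | [/\ Pstar g x mn.1, Pstar g x mn.2 & gcdn mn.1 mn.2 = 1%N]].

Lemma finite_coprime_pairs (R : realType) (g : nat) (x : R) :
  finite_set (coprime_pairs g x).
Proof.
apply: (@sub_finite_set _ _ (Pstar g x `*` Pstar g x)).
  by move=> mn [].
by apply: finite_setX; exact: finite_Pstar.
Qed.

(* The Riemann zeta function on the real half-line s > 1, where the series
   converges; no meaning is attached to other values of s. *)
Definition zeta (R : realType) (s : R) : R :=
  limn (series (fun k : nat => (k.+1%:R `^ s)^-1)).

(* Main.v *)
(* By Moebius inversion the number of coprime pairs is [sum_d mu(d) A_d^2], where
   [A_d] is the number of [n] in P*(x) divisible by [d]; only [d] coprime to
   [g^3 - g] and palindromes with an odd number [2 h + 1] of digits occur, and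
   [A_1] has order [g^H], where [g^(2H) <= x < g^(2H+2)].

   For [d < exp(c sqrt(log x))], fix the outer digits and expand the condition
   [d | n] in additive characters: the exponential sum over the inner digits is
   a product over digits, and among any [O(log d)] consecutive factors one is
   bounded away from 1.  Hence [A_d = A_1 / d] up to a relative error
   [exp(-c log x / log d)], and these [d] give the main term.

   For larger [d], say [d ~ y], fix all digits but about [log y / 4] central
   ones: what remains is injective modulo [d], so [A_d << g^H y^(-1/4)].
   Moreover [sum_(d ~ y) A_d << g^H y^(1/8)]: for small [y], by Cauchy-Schwarz
   the solutions of [d | n] are controlled by the collisions modulo [d] inside
   each of two disjoint blocks of about [log y] digits, and collisions are
   counted on average over [d] by the divisor bound; for large [y] the divisor
   bound is applied to [n] itself.  Together, [sum_(d ~ y) A_d^2] is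
   [O(g^(2H) y^(-1/8))]. *)
Require Import Defs.
From HB Require Import structures.
From mathcomp Require Import all_boot all_order all_algebra all_field.
From mathcomp Require Import finmap.
From mathcomp Require Import all_classical all_reals all_analysis.
From mathcomp Require Import zify ring lra.
Set Implicit Arguments.
Unset Strict Implicit.
Unset Printing Implicit Defensive.
Import Order.TTheory GRing.Theory Num.Theory.
Import numFieldNormedType.Exports.
Local Open Scope classical_set_scope.
Local Open Scope ring_scope.

(** * The divisor bound: the number of divisors is smaller than any power of [n] *)

Section DivisorBound.
Local Open Scope nat_scope.

(** The pointwise bound on [A_d] alone would give only [g^(2H) y^(1/2)] for the sum of squares over
    [d ~ y]. So one factor of [A_d^2] is bounded pointwise, with gain [y^(1/4)], and the other in
    mean, where any loss below [y^(1/4)] is affordable. The size of [d] is measured by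
    [g^k <= d < g^(k+1)], and the exponents 1/4 and 1/8 appear as [k %/ 4] and [k %/ 8].

    Coprimality of [d] and [g^3 - g] enters the character sums as follows. The weights of a
    palindrome mix [g^(h+i)] with its mirror [g^(h-i)]; eliminating the mirror between neighbouring
    digits raises the character to the power [(g^2 - 1) g^j], and a nontrivial character modulo [d]
    must survive this.

    The cut between small and large [d] is [g^(8u)] with [u] of order [sqrt H]: the window length
    and the number of windows are both proportional to [u], so they use up a multiple of [u^2]
    digits. Equidistribution, truncation of the Moebius series and the large [d] then all leave a
    relative error [O(g^(-u))].

    Counts are compared by inequalities between natural numbers with denominators cleared; complex
    numbers occur only inside the character sums. *)

Lemma size_divisors_pfactorM (p a m : nat) : prime p -> 0 < m ->
  size (divisors (p ^ a * m)) <= a.+1 * size (divisors m).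
Proof.
move=> pp m0.
have -> : a.+1 * size (divisors m) =
    size [seq p ^ i * e | i <- iota 0 a.+1, e <- divisors m].
  by rewrite size_allpairs size_iota.
apply: uniq_leq_size (divisors_uniq _) _ => d.
have pa0 : 0 < p ^ a by rewrite expn_gt0 prime_gt0.
rewrite -dvdn_divisors ?muln_gt0 ?pa0 // => dpam.
have d0 : 0 < d by apply: dvdn_gt0 dpam; rewrite muln_gt0 pa0.
have g0 : 0 < gcdn d (p ^ a) by rewrite gcdn_gt0 d0.
have /(dvdn_pfactor _ _ pp)[i ia gE] := dvdn_gcdr d (p ^ a).
(* The power of [p] is split off by the gcd with [p ^ a]; the cofactor is coprime to
   [p ^ a %/ gcdn d (p ^ a)] and therefore divides [m]. *)
apply/allpairsP; exists (i, d %/ gcdn d (p ^ a)); split.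
- by rewrite mem_iota add0n.
- rewrite /= -dvdn_divisors //.
  have : coprime (d %/ gcdn d (p ^ a)) (p ^ a %/ gcdn d (p ^ a)).
    rewrite /coprime -(eqn_pmul2r g0) mul1n muln_gcdl.
    by rewrite !divnK ?dvdn_gcdl ?dvdn_gcdr.
  move=> /Gauss_dvdr <-.
  by rewrite -(dvdn_pmul2r g0) mulnAC !divnK ?dvdn_gcdl ?dvdn_gcdr // mulnC.
- by rewrite /= -gE mulnC divnK ?dvdn_gcdl.
Qed.

(** This is the [K]-th power of [a + 1 <= K * 2 ^ (a %/ K)]. *)
Lemma leq_expn_linear (K a : nat) : 0 < K -> a.+1 ^ K <= K ^ K * 2 ^ a.
Proof.
move=> K0; have aE := divn_eq a K; have aK := ltn_pmod a K0.
have h1 : a.+1 <= K * 2 ^ (a %/ K).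
  apply: (@leq_trans (K * (a %/ K).+1)); first by rewrite mulnS; lia.
  by rewrite leq_mul2l ltn_expl ?orbT.
apply: (@leq_trans ((K * 2 ^ (a %/ K)) ^ K)); first by rewrite leq_exp2r.
by rewrite expnMn leq_mul2l -expnM leq_exp2l // leq_trunc_div orbT.
Qed.

(** A prime power [p ^ a] contributes [(a + 1) ^ K] on the left and [p ^ a] on the right. For
    [p >= 2 ^ K] one has [(a + 1) ^ K <= 2 ^ (a * K) <= p ^ a]; only the fewer than [2 ^ K] smaller
    primes cost a factor [K ^ K] each. *)
Lemma size_divisors_bound (K : nat) : 0 < K ->
  exists2 C, 0 < C & forall n, 0 < n -> size (divisors n) ^ K <= C * n.
Proof.
move=> K0; pose sm := [pred p | p < 2 ^ K].
have c0 : 0 < K ^ K by rewrite expn_gt0 K0.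
have key n : 0 < n ->
    size (divisors n) ^ K <= (K ^ K) ^ (count sm (primes n)) * n.
  elim/ltn_ind: n => n IH n0.
  have [n1|n1] := leqP n 1.
    have -> : n = 1 by lia.
    by rewrite (_ : divisors 1 = [:: 1]) //= exp1n muln1 expn_gt0 c0.
  have pp := pdiv_prime n1; set p := pdiv n in pp *.
  have [m pm nE] := pfactor_coprime pp n0; set a := logn p n in nE.
  have a0 : 0 < a by rewrite logn_gt0 mem_primes pp n0 pdiv_dvd.
  have m0 : 0 < m by move: n0; rewrite nE muln_gt0 => /andP[].
  have pa1 : 1 < p ^ a.
    by rewrite -(expn0 p) ltn_exp2l // prime_gt1.
  have mn : m < n by rewrite nE -{1}(muln1 m) ltn_mul2l m0.
  have cE : count sm (primes n) = sm p + count sm (primes m).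
    have -> : sm p + count sm (primes m) = count sm (p :: primes m) by [].
    apply/permP/uniq_perm; first exact: primes_uniq.
      rewrite /= primes_uniq andbT mem_primes pp m0 /=.
      by rewrite -prime_coprime.
    move=> q; rewrite nE primesM ?expn_gt0 ?(prime_gt0 pp) //.
    by rewrite primesX // (primes_prime pp) !inE orbC.
  have h1 : size (divisors n) <= a.+1 * size (divisors m).
    by rewrite nE mulnC size_divisors_pfactorM.
  apply: (@leq_trans ((a.+1 * size (divisors m)) ^ K)).
    by rewrite leq_exp2r.
  rewrite expnMn cE expnD.
  apply: leq_trans (leq_mul (_ : _ <= (K ^ K) ^ sm p * p ^ a) (IH m mn m0)) _.
    rewrite /sm /=; case: ltnP => pK.
      rewrite expn1; apply: leq_trans (leq_expn_linear a K0) _.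
      by rewrite leq_mul2l leq_exp2r ?prime_gt1 ?orbT.
    rewrite expn0 mul1n; apply: (@leq_trans ((2 ^ a) ^ K)).
      by rewrite leq_exp2r // ltn_expl.
    by rewrite -expnM mulnC expnM leq_exp2r.
  by rewrite [in leqRHS]nE; apply: eq_leq; ring.
exists ((K ^ K) ^ (2 ^ K)) => [|n n0]; first by rewrite expn_gt0 c0.
apply: leq_trans (key n n0) _; rewrite leq_mul2r; apply/orP; right.
rewrite leq_pexp2l // -size_filter -[leqRHS](size_iota 0).
apply: uniq_leq_size; first by rewrite filter_uniq ?primes_uniq.
by move=> q; rewrite mem_filter mem_iota => /andP[].
Qed.

End DivisorBound.

(** * The Moebius function *)

Section Moebius.
Local Open Scope nat_scope.

Definition moebius (n : nat) : int :=
  if all (fun p => logn p n == 1) (primes n)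
  then ((-1) ^+ size (primes n))%R else 0%R.

Lemma norm_moebius (n : nat) : (`|moebius n| <= 1)%R.
Proof.
by rewrite /moebius; case: ifP => _; rewrite ?normr0 // normrX normrN1 expr1n.
Qed.

Lemma moebius_prime_mul (p e : nat) : prime p -> 0 < e ->
  moebius (p * e) = (if (p %| e)%N then 0 else - moebius e)%R.
Proof.
move=> pp e0; have p0 := prime_gt0 pp.
have mem q : (q \in primes (p * e)) = (q == p) || (q \in primes e).
  by rewrite primesM // primes_prime // inE.
rewrite /moebius; case: (boolP (p %| e)) => [pe|npe].
  rewrite ifF //; apply/negP => /allP/(_ p); rewrite mem eqxx => /(_ isT).
  have : 0 < logn p e by rewrite logn_gt0 mem_primes pp e0.
  by rewrite lognM // (logn_prime _ pp) eqxx add1n eqSS => /lt0n_neq0/negP.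
have perm : perm_eq (primes (p * e)) (p :: primes e).
  apply: uniq_perm; rewrite ?primes_uniq //= ?primes_uniq ?andbT.
    by rewrite mem_primes pp e0.
rewrite (perm_all _ perm) (perm_size perm) /= lognM // (logn_prime _ pp) eqxx.
have -> : logn p e = 0 by apply/eqP; rewrite -leqn0 leqNgt logn_gt0 mem_primes pp e0.
rewrite addn0 eqxx /=.
have -> : all (fun q => logn q (p * e) == 1) (primes e) =
          all (fun q => logn q e == 1) (primes e).
  apply: eq_in_all => q; rewrite mem_primes => /and3P[pq _ qe].
  rewrite lognM // (logn_prime _ pp); case: (eqVneq q p) => [qp|_] //.
  by rewrite -qp qe in npe.
by case: ifP => _; rewrite ?oppr0 // exprS mulN1r.
Qed.

(** For a prime factor [p] of [n], the divisors [p * e] with [p] not dividing [e] cancel against the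
    divisors prime to [p], and the multiples of [p ^ 2] contribute 0. *)
Lemma sum_moebius_divisors (n : nat) : 0 < n ->
  (\sum_(d <- divisors n) moebius d)%R = (n == 1)%:R%R.
Proof.
move=> n0; have [n1|n1] := leqP n 1.
  have -> : n = 1 by lia.
  by rewrite (_ : divisors 1 = [:: 1]) // big_seq1.
have pp := pdiv_prime n1; set p := pdiv n in pp *.
have pn : p %| n by apply: pdiv_dvd.
have -> : (n == 1) = false by lia.
have p0 := prime_gt0 pp.
have np0 : 0 < n %/ p by rewrite divn_gt0 // dvdn_leq.
rewrite (bigID (fun d => p %| d)) /=.
rewrite -[X in (X + _)%R]big_filter.
have perm : perm_eq [seq d <- divisors n | p %| d]
                    [seq p * e | e <- divisors (n %/ p)].
  apply: uniq_perm; first by rewrite filter_uniq ?divisors_uniq.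
    rewrite map_inj_uniq ?divisors_uniq // => a b /eqP.
    by rewrite eqn_pmul2l // => /eqP.
  move=> d; rewrite mem_filter -dvdn_divisors //; apply/andP/mapP.
    move=> [/dvdnP[e ->] ed]; exists e; last by rewrite mulnC.
    by rewrite -dvdn_divisors // -(dvdn_pmul2r p0) divnK.
  move=> [e + ->]; rewrite -dvdn_divisors // => ed.
  by rewrite dvdn_mulr // -(divnK pn) mulnC dvdn_pmul2r.
rewrite (perm_big _ perm) big_map.
rewrite (bigID (fun d => p %| d)) /= big_seq_cond big1 ?add0r; last first.
  move=> e /andP[+ pe]; rewrite -dvdn_divisors // => en.
  by rewrite moebius_prime_mul ?pe // (dvdn_gt0 np0 en).
rewrite -[X in (X + _)%R]big_filter -[X in (_ + X)%R]big_filter.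
have perm2 : perm_eq [seq e <- divisors n | ~~ (p %| e)]
                     [seq e <- divisors (n %/ p) | ~~ (p %| e)].
  apply: uniq_perm; rewrite ?filter_uniq ?divisors_uniq // => d.
  rewrite !mem_filter -!dvdn_divisors //; case: (boolP (p %| d)) => //= pd.
  rewrite -{1}(divnK pn) Gauss_dvdl // coprime_sym prime_coprime //.
rewrite (perm_big _ perm2) -big_split /= big_seq big1 // => e.
rewrite mem_filter -dvdn_divisors // => /andP[pe en].
by rewrite moebius_prime_mul ?(negPf pe) ?(dvdn_gt0 np0 en) // addNr.
Qed.

End Moebius.

(** * Palindromes as sums of digit blocks *)

Section Blocks.
Local Open Scope nat_scope.

Lemma big_nat_muln (R : Type) (idx : R) (op : Monoid.law idx) (m m' n : nat)
    (F : nat -> R) : m <= m' ->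
  \big[op/idx]_(m * n <= a < m' * n) F a =
  \big[op/idx]_(m <= b < m') \big[op/idx]_(0 <= e < n) F (b * n + e).
Proof.
move=> /subnK <-; elim: (m' - m) => [|k IH]; first by rewrite add0n !big_geq.
rewrite addSn big_nat_recr ?leq_addl //= -IH mulSn addnC.
rewrite (big_cat_nat _ (n := (k + m) * n)) ?leq_mul2r ?leq_addl ?orbT ?leq_addr //.
congr (op _ _); rewrite -{1}[(k + m) * n]add0n big_addn addKn.
by apply: eq_bigr => e _; rewrite addnC.
Qed.

Lemma big_nat0_muln (R : Type) (idx : R) (op : Monoid.law idx) (m n : nat)
    (F : nat -> R) :
  \big[op/idx]_(0 <= a < m * n) F a =
  \big[op/idx]_(0 <= b < m) \big[op/idx]_(0 <= e < n) F (b * n + e).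
Proof. by rewrite -(big_nat_muln op n F (leq0n m)) mul0n. Qed.

Lemma sum_expn_lt (g n : nat) : 1 < g -> \sum_(0 <= i < n) g ^ i < g ^ n.
Proof.
move=> g1; elim: n => [|n IH]; first by rewrite big_geq.
by rewrite big_nat_recr //= expnS; nia.
Qed.

Lemma sum_nat_le1 (n : nat) (P : nat -> bool) :
  (forall e e', e < e' < n -> P e -> P e' -> False) ->
  \sum_(0 <= e < n) P e <= 1.
Proof.
elim: n => [|n IH] H; first by rewrite big_geq.
rewrite big_nat_recr //=; case Pn : (P n); last first.
  by rewrite addn0; apply: IH => e e' /andP[? ?]; apply: H; lia.
rewrite big_nat big1 // => e en; case Pe : (P e) => //.
by case: (H e n _ Pe Pn); lia.
Qed.

Definition digit (g a i : nat) : nat := (a %/ g ^ i) %% g.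

(* In a palindrome with [2 h + 1] digits, a digit [c] at distance [i] from the
   centre contributes [c * weight g h i]. *)
Definition weight (g h i : nat) : nat :=
  if i == 0 then g ^ h else g ^ (h + i) + g ^ (h - i).

(* The contribution of the digits at distance [s, ..., s + T - 1] from the centre
   when they are read off [e] in base [g]. *)
Definition block (g h s T e : nat) : nat :=
  \sum_(0 <= i < T) digit g e i * weight g h (s + i).

(* For [g^h <= a < g^(h+1)]: the palindrome with [2 h + 1] digits whose leading
   [h + 1] digits form [a]. *)
Definition pal (g h a : nat) : nat := block g h 0 h.+1 a.

Lemma digit_lt (g a i : nat) : 1 < g -> digit g a i < g.
Proof. by move=> g1; rewrite ltn_pmod // ltnW. Qed.

Lemma digit_low (g T e' e i : nat) : 1 < g -> i < T ->
  digit g (e' * g ^ T + e) i = digit g e i.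
Proof.
move=> g1 iT; have gi : 0 < g ^ i by rewrite expn_gt0 ltnW.
rewrite /digit -(subnK (ltnW iT)) expnD mulnA divnMDl //.
by rewrite -(subnSK iT) expnS mulnCA (mulnC g) modnMDl.
Qed.

Lemma digit_high (g T e' e i : nat) : 1 < g -> e < g ^ T ->
  digit g (e' * g ^ T + e) (T + i) = digit g e' i.
Proof.
move=> g1 eT; have gT : 0 < g ^ T by rewrite expn_gt0 ltnW.
by rewrite /digit expnD divnMA divnMDl // (divn_small eT) addn0.
Qed.

Lemma sum_digits (g T e : nat) : 1 < g -> e < g ^ T ->
  \sum_(0 <= i < T) digit g e i * g ^ i = e.
Proof.
move=> g1; elim: T e => [|T IH] e eT.
  by rewrite big_geq //; move: eT; rewrite expn0; lia.
have gT : 0 < g ^ T by rewrite expn_gt0 ltnW.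
rewrite big_nat_recr //= /digit.
have dT : e %/ g ^ T < g by rewrite ltn_divLR // -expnS.
rewrite [in X in _ + X]modn_small // [in RHS](divn_eq e (g ^ T)) addnC.
congr (_ + _); rewrite -[RHS]IH ?ltn_pmod // big_nat [RHS]big_nat.
apply: eq_bigr => i /andP[_ iT].
by rewrite -/(digit g e i) {1}(divn_eq e (g ^ T)) digit_low.
Qed.

Lemma block_split (g h s T T' e' e : nat) : 1 < g -> e < g ^ T ->
  block g h s (T + T') (e' * g ^ T + e) =
  block g h s T e + block g h (s + T) T' e'.
Proof.
move=> g1 eT; rewrite /block (big_cat_nat _ (n := T)) ?leq_addr //=.
congr (_ + _).
  by rewrite big_nat [RHS]big_nat; apply: eq_bigr => i iT; rewrite digit_low.
rewrite -{1}(add0n T) big_addn addKn; apply: eq_bigr => i _.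
by rewrite [i + T]addnC digit_high // addnA.
Qed.

(** The mirrored half of a block: the same digits at the positions below the centre. The central
    digit has no mirror image, hence the 0 at distance 0. *)
Definition block_rev (g h s T e : nat) : nat :=
  \sum_(0 <= i < T) digit g e i * (if s + i == 0 then 0 else g ^ (h - (s + i))).

Lemma blockE (g h s T e : nat) : 1 < g -> e < g ^ T ->
  block g h s T e = e * g ^ (h + s) + block_rev g h s T e.
Proof.
move=> g1 eT; rewrite -{2}(sum_digits g1 eT) big_distrl /= -big_split /=.
apply: eq_bigr => i _; rewrite -mulnA -expnD -mulnDr /weight.
case: eqP => [si|_]; last by rewrite (addnC i) addnA.
by rewrite addn0 (_ : i + (h + s) = h) //; lia.
Qed.

Lemma block_rev_lt (g h s T e : nat) : 1 < g -> s + T <= h.+1 ->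
  block_rev g h s T e < g ^ (h + s).
Proof.
move=> g1 sT.
(* Strengthened for the induction: there is still room for one unit at the lowest position in use.
   [maxn s 1] skips the centre. *)
have key : 0 < s + T ->
    block_rev g h s T e + g ^ (h.+1 - (s + T)) <= g ^ (h.+1 - maxn s 1).
  elim: T sT => [|T IH] sT sT0.
    by rewrite /block_rev big_geq // leq_exp2l //; lia.
  rewrite /block_rev big_nat_recr //= -/(block_rev g h s T e).
  have dg := digit_lt e T g1.
  case: eqP => [sT1|/eqP sT1].
    rewrite muln0 addn0 /block_rev big_geq; last by lia.
    by rewrite leq_exp2l //; lia.
  apply: leq_trans (IH _ _); rewrite ?lt0n //; last by lia.
  have -> : h.+1 - (s + T) = (h - (s + T)).+1 by lia.
  have -> : h.+1 - (s + T.+1) = h - (s + T) by lia.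
  by rewrite -addnA leq_add2l expnS addnC -mulSn leq_mul2r dg orbT.
have gp n : 0 < g ^ n by rewrite expn_gt0 ltnW.
have [sT0|sT0] := posnP (s + T).
  by rewrite /block_rev big_geq //; lia.
have := key sT0; have := gp (h.+1 - (s + T)).
have : g ^ (h.+1 - maxn s 1) <= g ^ (h + s) by rewrite leq_exp2l //; lia.
lia.
Qed.

(** The mirrored half is smaller than one unit of the upper half, which makes a block strictly
    increasing in [e]. *)
Lemma block_bounds (g h s T e : nat) : 1 < g -> s + T <= h.+1 -> e < g ^ T ->
  e * g ^ (h + s) <= block g h s T e < e.+1 * g ^ (h + s).
Proof.
move=> g1 sT eT; rewrite blockE // leq_addr mulSn addnC ltn_add2r.
exact: block_rev_lt.
Qed.

Lemma dvdn_block (g h s T e : nat) : s + T <= h.+1 ->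
  g ^ (h.+1 - (s + T)) %| block g h s T e.
Proof.
move=> sT; rewrite /block big_nat; apply: dvdn_sum => i /andP[_ iT].
apply: dvdn_mull; rewrite /weight; case: eqP => [si|_].
  by apply: dvdn_exp2l; lia.
by apply: dvdn_add; apply: dvdn_exp2l; lia.
Qed.

Lemma block_lt (g h s T e e' : nat) : 1 < g -> s + T <= h.+1 ->
  e' < g ^ T -> e < e' -> block g h s T e < block g h s T e'.
Proof.
move=> g1 sT eT ee.
have /andP[_ h1] := block_bounds g1 sT (ltn_trans ee eT).
have /andP[h2 _] := block_bounds g1 sT eT.
by apply: leq_trans h1 (leq_trans _ h2); rewrite leq_mul2r ee orbT.
Qed.

Lemma block_ltX (g h s T e : nat) : 1 < g -> s + T <= h.+1 ->
  e < g ^ T -> block g h s T e < g ^ (h + s + T).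
Proof.
move=> g1 sT eT; have /andP[_] := block_bounds g1 sT eT.
move=> /leq_trans; apply.
by rewrite [leqRHS]expnD [leqRHS]mulnC leq_mul2r eT orbT.
Qed.

Lemma pal_bounds (g h a : nat) : 1 < g -> a < g ^ h.+1 ->
  a * g ^ h <= pal g h a < a.+1 * g ^ h.
Proof.
by move=> g1 ah; have := @block_bounds g h 0 h.+1 a g1 (leqnn _) ah; rewrite addn0.
Qed.

Lemma pal_lt (g h a a' : nat) : 1 < g -> a' < g ^ h.+1 -> a < a' ->
  pal g h a < pal g h a'.
Proof. by move=> g1; apply: block_lt. Qed.

Lemma pal_ltX (g h a : nat) : 1 < g -> a < g ^ h.+1 -> pal g h a < g ^ (2 * h).+1.
Proof.
move=> g1 ah; have := @block_ltX g h 0 h.+1 a g1 (leqnn _) ah.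
by rewrite (_ : h + 0 + h.+1 = (2 * h).+1) //; lia.
Qed.

Lemma pal_split (g h r b e : nat) : 1 < g -> r <= h -> e < g ^ r ->
  pal g h (b * g ^ r + e) = block g h 0 r e + block g h r (h.+1 - r) b.
Proof.
move=> g1 rh er; rewrite /pal -{1}(subnKC (leqW rh)) block_split //.
Qed.

(** In a box the outer digits [b] are fixed and enter only as an additive constant, while the [r]
    digits nearest the centre run freely. *)
Lemma sum_pal_boxes (g h r : nat) (F : nat -> nat) : 1 < g -> r <= h ->
  \sum_(g ^ h <= a < g ^ h.+1) F (pal g h a) =
  \sum_(g ^ (h - r) <= b < g ^ (h - r).+1) \sum_(0 <= e < g ^ r)
     F (block g h 0 r e + block g h r (h.+1 - r) b).
Proof.
move=> g1 rh.
have -> : g ^ h = g ^ (h - r) * g ^ r by rewrite -expnD subnK.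
have -> : g ^ h.+1 = g ^ (h - r).+1 * g ^ r by rewrite -expnD addSn subnK.
rewrite big_nat_muln ?leq_exp2l //; apply: eq_bigr => b _.
by rewrite big_nat [RHS]big_nat; apply: eq_bigr => e /andP[_ er]; rewrite pal_split.
Qed.

End Blocks.

(** * Palindromes divisible by [d], for a single [d] and on average *)

Section DivisibleCounts.
Local Open Scope nat_scope.

Definition pal_mult (g h d : nat) : nat :=
  \sum_(g ^ h <= a < g ^ h.+1) (d %| pal g h a).

Lemma pal_mult_triv (g h d : nat) : pal_mult g h d <= g ^ h.+1.
Proof.
apply: (@leq_trans (\sum_(g ^ h <= a < g ^ h.+1) 1)).
  by apply: leq_sum => a _; exact: leq_b1.
by rewrite sum_nat_const_nat muln1 leq_subr.
Qed.

Lemma sum_succ_pow_le (g n : nat) : 1 < g -> \sum_(0 <= h < n) g ^ h.+1 <= g ^ n.+1.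
Proof.
move=> g1; rewrite expnS.
under eq_bigr => h _ do rewrite expnS.
by rewrite -big_distrr /= leq_mul2l ltnW ?orbT // sum_expn_lt.
Qed.

(** Both blocks are multiples of the same power of [g], and [d] is coprime to [g]: a congruence
    modulo [d] gains that power for free. *)
Lemma dvdn_block_sub (g h s T d e e' : nat) : 1 < g -> s + T <= h.+1 ->
  coprime d g -> block g h s T e = block g h s T e' %[mod d] ->
  d * g ^ (h.+1 - (s + T)) %| block g h s T e' - block g h s T e.
Proof.
move=> g1 sT dg ee; rewrite Gauss_dvd ?coprimeXr //.
apply/andP; split; last by rewrite dvdn_sub ?dvdn_block.
have [le|/ltnW le] := leqP (block g h s T e) (block g h s T e').
  by rewrite -eqn_mod_dvd // ee.
by rewrite (_ : _ - _ = 0) ?dvdn0 //; apply/eqP; rewrite subn_eq0.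
Qed.

(** Two distinct central blocks congruent modulo [d] would differ by at least
    [d * g ^ (h.+1 - r) >= g ^ (h + r + 1)], more than any block of [r] digits. So each choice of
    the outer digits admits at most one solution. *)
Lemma pal_mult_sparse (g h r d : nat) : 1 < g -> r <= h -> coprime d g ->
  g ^ (2 * r) <= d -> pal_mult g h d <= g ^ (h - r).+1.
Proof.
move=> g1 rh dg rd.
rewrite /pal_mult (sum_pal_boxes (fun n => nat_of_bool (d %| n)) g1 rh).
apply: (@leq_trans (\sum_(g ^ (h - r) <= b < g ^ (h - r).+1) 1)); last first.
  by rewrite sum_nat_const_nat muln1 leq_subr.
apply: leq_sum => b _; set c := block g h r _ b.
apply: sum_nat_le1 => e e' /andP[ee er] d1 d2.
have r1 : 0 + r <= h.+1 by rewrite add0n leqW.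
have lt := block_lt g1 r1 er ee.
have ub := block_ltX g1 r1 er.
have : block g h 0 r e = block g h 0 r e' %[mod d].
  apply/eqP; rewrite -(eqn_modDr c); move: d1 d2.
  by rewrite /dvdn => /eqP-> /eqP->.
move=> /(dvdn_block_sub g1 r1 dg)/dvdn_leq.
rewrite subn_gt0 lt => /(_ isT) H.
have : g ^ (2 * r) * g ^ (h.+1 - (0 + r)) <= block g h 0 r e' - block g h 0 r e.
  by apply: leq_trans H; rewrite leq_mul2r rd orbT.
rewrite -expnD => H2.
have : g ^ (h + 0 + r) <= g ^ (2 * r + (h.+1 - (0 + r))) by rewrite leq_exp2l //; lia.
lia.
Qed.

(* AM-GM over the common value: 2 N1 N2 <= N1^2 + N2^2. *)
Lemma double_count_le (J : finType) (n : nat) (P Q : nat -> J) :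
  2 * (\sum_(0 <= i < n) \sum_(0 <= j < n) (P i == Q j)) <=
  \sum_(0 <= i < n) \sum_(0 <= j < n) (P i == P j) +
  \sum_(0 <= i < n) \sum_(0 <= j < n) (Q i == Q j).
Proof.
have key (A B : nat -> J) :
    \sum_(0 <= i < n) \sum_(0 <= j < n) (A i == B j) =
    \sum_v (\sum_(0 <= i < n) (A i == v)) * (\sum_(0 <= j < n) (B j == v)).
  under [RHS]eq_bigr => v _ do rewrite big_distrl /=.
  rewrite [RHS]exchange_big /=; apply: eq_bigr => i _.
  under [RHS]eq_bigr => v _ do rewrite big_distrr /=.
  rewrite [RHS]exchange_big /=; apply: eq_bigr => j _.
  rewrite (bigD1 (A i)) //= eqxx mul1n big1 ?addn0 1?eq_sym // => v.
  by rewrite eq_sym => /negPf->.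
rewrite !key -big_split big_distrr /=; apply: leq_sum => v _.
set a := \sum_(_ <= _ < _) _; set b := \sum_(_ <= _ < _) _.
move: a b => a b.
by case/orP: (leq_total a b) => /subnK <-; nia.
Qed.

(** In [Z/d] the condition reads [p i = - (q j + c)], and collisions of [- (q j + c)] are collisions
    of [q], so that [c] disappears on the right. *)
Lemma dvdn_pairs_le (d n c : nat) (p q : nat -> nat) : 0 < d ->
  2 * (\sum_(0 <= i < n) \sum_(0 <= j < n) (d %| p i + q j + c)) <=
  \sum_(0 <= i < n) \sum_(0 <= j < n) (p i == p j %[mod d]) +
  \sum_(0 <= i < n) \sum_(0 <= j < n) (q i == q j %[mod d]).
Proof.
case: d => // d _.
pose P i : 'I_d.+1 := inZp (p i); pose Q j : 'I_d.+1 := (- inZp (q j + c))%R.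
have PQ i j : (d.+1 %| p i + q j + c) = (P i == Q j).
  rewrite /Q -subr_eq0 opprK /P -val_eqE /= modnDm addnA.
  by [].
have PP i j : (p i == p j %[mod d.+1]) = (P i == P j) by [].
have QQ i j : (q i == q j %[mod d.+1]) = (Q i == Q j).
  by rewrite /Q (inj_eq oppr_inj) -val_eqE /= eqn_modDr.
have E (f f' : nat -> nat -> bool) : (forall i j, f i j = f' i j) ->
    \sum_(0 <= i < n) \sum_(0 <= j < n) f i j =
    \sum_(0 <= i < n) \sum_(0 <= j < n) f' i j.
  by move=> ff; apply: eq_bigr => i _; apply: eq_bigr => j _; rewrite ff.
rewrite (E _ _ PQ) (E _ _ PP) (E _ _ QQ); exact: double_count_le.
Qed.

Lemma sum_dvdn_le (m n z : nat) : 0 < z ->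
  \sum_(m <= d < n) (d %| z) <= size (divisors z).
Proof.
move=> z0; rewrite -big_mkcond /= sum1_count -size_filter.
apply: uniq_leq_size; first by rewrite filter_uniq ?iota_uniq.
by move=> d; rewrite mem_filter -dvdn_divisors // => /andP[].
Qed.

(** Let [T = k.+1]. Diagonal pairs are counted trivially and cost [g ^ (2 * T)]. Off the diagonal,
    [d] divides the difference of the blocks even after their common power of [g] is removed; since
    [s <= T], the quotient is a positive integer below [g ^ (4 * T)], with at most [B] divisors. *)
Lemma sum_collisions_le (g h s k B : nat) : 1 < g ->
  s <= k.+1 -> s + k.+1 <= h.+1 ->
  (forall z, 0 < z < g ^ (4 * k.+1) -> size (divisors z) <= B) ->
  \sum_(g ^ k <= d < g ^ k.+1 | coprime d g)
     \sum_(0 <= e < g ^ k.+1) \sum_(0 <= e' < g ^ k.+1)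
       (block g h s k.+1 e == block g h s k.+1 e' %[mod d]) <=
  g ^ (2 * k.+1) * B.+1.
Proof.
move=> g1 sk sh HB; set T := k.+1 in sk sh HB *.
rewrite exchange_big /=.
apply: (@leq_trans (\sum_(0 <= e < g ^ T) (g ^ T * B.+1))); last first.
  by rewrite sum_nat_const_nat subn0 mulnA -expnD mul2n addnn.
rewrite big_nat [X in _ <= X]big_nat; apply: leq_sum => e /andP[_ eT].
rewrite exchange_big /=.
apply: (@leq_trans (\sum_(0 <= e' < g ^ T) ((e' == e) * g ^ T + B))); last first.
  rewrite big_split /= sum_nat_const_nat subn0 mulnS leq_add2r -big_distrl /=.
  apply: (@leq_trans (1 * g ^ T)); last by rewrite mul1n.
  rewrite leq_mul2r; apply/orP; right.
  by apply: sum_nat_le1 => a b /andP[ab _] /eqP ae /eqP be; lia.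
rewrite big_nat [X in _ <= X]big_nat; apply: leq_sum => e' /andP[_ eT'].
have [->|ne] := eqVneq e' e.
  apply: (@leq_trans (\sum_(g ^ k <= d < g ^ T) 1)).
    rewrite big_mkcond /=; apply: leq_sum => d _; case: ifP => // _.
    exact: leq_b1.
  by rewrite sum_nat_const_nat muln1 mul1n; apply: leq_trans (leq_subr _ _) (leq_addr _ _).
rewrite mul0n add0n.
have gz : 0 < g ^ (h.+1 - (s + T)) by rewrite expn_gt0 ltnW.
wlog : e e' eT eT' ne / e < e' => [W|lt].
  have [lt|le] := ltnP e e'; first exact: W.
  have lt : e' < e by rewrite ltn_neqAle ne.
  have H := W e' e eT' eT _ lt; rewrite eq_sym in H.
  apply: leq_trans (H ne); apply: eq_leq; apply: eq_bigr => d _.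
  by rewrite eq_sym.
set G := g ^ _ in gz; set D := block g h s T e' - block g h s T e.
have D0 : 0 < D by rewrite subn_gt0 block_lt.
have GD : G %| D by rewrite dvdn_sub ?dvdn_block.
have z0 : 0 < D %/ G by rewrite divn_gt0 // dvdn_leq.
apply: leq_trans (HB (D %/ G) _); last first.
  rewrite z0 ltn_divLR //; apply: leq_ltn_trans (leq_subr _ _) _.
  apply: leq_trans (block_ltX g1 sh eT') _.
  by rewrite /G -expnD leq_exp2l //; lia.
apply: leq_trans (sum_dvdn_le (g ^ k) (g ^ T) z0).
rewrite big_mkcond /=; apply: leq_sum => d _; case: ifP => // dg.
case: eqP => //= ee; rewrite -(dvdn_pmul2r gz) divnK //.
by rewrite dvdn_block_sub.
Qed.

Lemma sum_pal_mult_small (g h k B : nat) : 1 < g -> 2 * k.+1 <= h ->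
  (forall z, 0 < z < g ^ (4 * k.+1) -> size (divisors z) <= B) ->
  \sum_(g ^ k <= d < g ^ k.+1 | coprime d g) pal_mult g h d <=
  g ^ h.+1 * B.+1.
Proof.
move=> g1 kh HB; set T := k.+1 in kh HB *.
have gk : 0 < g ^ k by rewrite expn_gt0 ltnW.
under eq_bigr => d _ do
  rewrite /pal_mult (sum_pal_boxes (fun n => nat_of_bool (d %| n)) g1 kh).
rewrite exchange_big /=.
apply: (@leq_trans (\sum_(g ^ (h - 2 * T) <= b < g ^ (h - 2 * T).+1)
                     (g ^ (2 * T) * B.+1))); last first.
  rewrite sum_nat_const_nat mulnA leq_mul2r; apply/orP; right.
  apply: (@leq_trans (g ^ (h - 2 * T).+1 * g ^ (2 * T))).
    by rewrite leq_mul2r leq_subr orbT.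
  by rewrite -expnD addSn subnK.
apply: leq_sum => b _; set c := block g h (2 * T) _ b.
rewrite -(leq_pmul2l (isT : 0 < 2)) big_distrr /=.
have T1 : 0 + T <= h.+1 by lia.
have T2 : T + T <= h.+1 by lia.
have cl0 := sum_collisions_le g1 (leq0n _) T1 HB.
have cl1 := sum_collisions_le g1 (leqnn _) T2 HB.
apply: leq_trans (_ : _ <= _ + _) _; last first.
  by rewrite [2 * _]mul2n -addnn; exact: leq_add cl0 cl1.
rewrite -big_split /= big_nat_cond [X in _ <= X]big_nat_cond.
apply: leq_sum => d /andP[/andP[kd _] dg].
have d0 : 0 < d by apply: leq_trans gk kd.
apply: leq_trans (dvdn_pairs_le _ c _ _ d0); rewrite leq_mul2l /=.
rewrite exchange_big /= {1}mul2n -addnn expnD -[g ^ T * g ^ T]/(g ^ T * g ^ T).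
rewrite big_nat0_muln; apply: eq_leq.
apply: eq_bigr => e2 _; rewrite big_nat [RHS]big_nat; apply: eq_bigr => e1 /andP[_ e1T].
by rewrite [2 * T]mul2n -addnn block_split // add0n.
Qed.

Lemma sum_pal_mult_large (g h k B : nat) : 1 < g ->
  (forall z, 0 < z < g ^ (2 * h).+1 -> size (divisors z) <= B) ->
  \sum_(g ^ k <= d < g ^ k.+1 | coprime d g) pal_mult g h d <= g ^ h.+1 * B.
Proof.
move=> g1 HB; rewrite /pal_mult exchange_big /=.
apply: (@leq_trans (\sum_(g ^ h <= a < g ^ h.+1) B)); last first.
  by rewrite sum_nat_const_nat leq_mul2r leq_subr orbT.
rewrite big_nat [X in _ <= X]big_nat; apply: leq_sum => a /andP[ha ah].
have gh : 0 < g ^ h by rewrite expn_gt0 ltnW.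
have p0 : 0 < pal g h a.
  have /andP[+ _] := pal_bounds g1 ah; apply: leq_trans.
  by rewrite muln_gt0 gh (leq_trans gh ha).
have pB : size (divisors (pal g h a)) <= B by apply: HB; rewrite p0 pal_ltX.
apply: leq_trans pB.
apply: leq_trans (sum_dvdn_le (g ^ k) (g ^ k.+1) p0).
by rewrite big_mkcond /=; apply: leq_sum => d _; case: ifP.
Qed.

End DivisibleCounts.

(** * First and second moments over the range [g^k <= d < g^(k+1)] *)

Section Moments.
Local Open Scope nat_scope.

Lemma sum_shift_pow_le (g r n : nat) : 1 < g ->
  \sum_(r <= h < n) g ^ (h - r).+1 <= g ^ (n - r).+1.
Proof.
move=> g1; rewrite -{1}(add0n r) big_addn.
under eq_bigr => h _ do rewrite addnK.
exact: sum_succ_pow_le.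
Qed.

(** Palindromes with [h < r] are too short for [pal_mult_sparse]; counted trivially they stay within
    the bound because [2 * r <= H]. *)
Lemma total_mult_sparse (g H r d : nat) : 1 < g -> 2 * r <= H ->
  coprime d g -> g ^ (2 * r) <= d ->
  \sum_(0 <= h < H.+1) pal_mult g h d <= 2 * g ^ (H - r).+2.
Proof.
move=> g1 rH dg rd; rewrite (big_cat_nat _ (n := r)) //=; last by lia.
rewrite mul2n -addnn; apply: leq_add.
  apply: (@leq_trans (g ^ r.+1)); last by rewrite leq_exp2l //; lia.
  apply: leq_trans (sum_succ_pow_le r g1); apply: leq_sum => h _.
  exact: pal_mult_triv.
have -> : (H - r).+2 = (H.+1 - r).+1 by lia.
apply: leq_trans (sum_shift_pow_le r H.+1 g1).
rewrite big_nat [leqRHS]big_nat; apply: leq_sum => h /andP[rh _].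
exact: pal_mult_sparse.
Qed.

Lemma total_mult_mean (g : nat) : 1 < g ->
  exists2 C, 0 < C & forall k H,
    \sum_(g ^ k <= d < g ^ k.+1 | coprime d g)
      \sum_(0 <= h < H.+1) pal_mult g h d <= C * g ^ (H + k %/ 8).
Proof.
move=> g1; have g0 : 0 < g by apply: ltnW.
(* [48 = 6 * 8]: numbers below [g ^ (6 * k.+1)] then have [O(g ^ (k %/ 8))] divisors. *)
have [C0 C00 HC] := @size_divisors_bound 48 isT.
have tauB k z : 0 < z < g ^ (6 * k.+1) -> size (divisors z) <= C0 * g ^ (k %/ 8).+1.
  move=> /andP[z0 zk]; rewrite -(@leq_exp2r _ _ 48) //.
  apply: leq_trans (HC z z0) _; rewrite expnMn -expnM.
  apply: leq_mul; first by rewrite -{1}(expn1 C0) leq_pexp2l.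
  apply: leq_trans (ltnW zk) _; rewrite leq_exp2l //.
  by have := ltn_ceil k (isT : 0 < 8); lia.
exists (g + g ^ 2 * (C0 * g + 1)) => [|k H]; first by rewrite addn_gt0 g0.
set u := k %/ 8; set B := C0 * g ^ u.+1.
have gu : 0 < g ^ u by rewrite expn_gt0 g0.
have gH : 0 < g ^ H by rewrite expn_gt0 g0.
have target : g ^ H.+1 + g ^ H.+2 * B.+1 <= (g + g ^ 2 * (C0 * g + 1)) * g ^ (H + u).
  rewrite /B expnD !expnS expn0 muln1.
  move: (g ^ u) (g ^ H) gu gH => a b a0 b0.
  rewrite mulnDl; apply: leq_add; first by rewrite leq_mul2l leq_pmulr ?orbT.
  by rewrite -!mulnA !leq_pmul2l // -addn1; nia.
apply: leq_trans target; rewrite exchange_big /=.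
(* If [3 * k.+1 <= H], the palindromes with [h < 2 * k.+1] cannot hold two blocks; counted trivially
   they total at most [g ^ H.+1]. Otherwise every palindrome has at most [6 * k.+1] digits and its
   own divisors can be counted. *)
have [kH|kH] := leqP (3 * k.+1) H.
  rewrite (big_cat_nat _ (n := 2 * k.+1)) //=; last by lia.
  apply: leq_add.
    apply: (@leq_trans (\sum_(0 <= h < 2 * k.+1) (g ^ k.+1 * g ^ h.+1))).
      apply: leq_sum => h _.
      apply: (@leq_trans (\sum_(g ^ k <= d < g ^ k.+1) g ^ h.+1)).
        rewrite big_mkcond /=; apply: leq_sum => d _; case: ifP => // _.
        exact: pal_mult_triv.
      by rewrite sum_nat_const_nat leq_mul2r leq_subr orbT.
    rewrite -big_distrr /=.
    apply: (@leq_trans (g ^ k.+1 * g ^ (2 * k.+1).+1)).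
      by rewrite leq_mul2l sum_succ_pow_le ?orbT.
    by rewrite -expnD leq_exp2l //; lia.
  apply: (@leq_trans (\sum_(2 * k.+1 <= h < H.+1) g ^ h.+1 * B.+1)).
    rewrite big_nat [leqRHS]big_nat; apply: leq_sum => h /andP[kh _].
    apply: sum_pal_mult_small => // z /andP[z0 zk]; apply: tauB; rewrite z0 /=.
    by apply: leq_trans zk _; rewrite leq_exp2l //; lia.
  rewrite -big_distrl /= leq_mul2r; apply/orP; right.
  apply: leq_trans (sum_succ_pow_le H.+1 g1).
  by rewrite [leqRHS](big_cat_nat _ (n := 2 * k.+1)) ?leq_addl //; lia.
apply: (@leq_trans (g ^ H.+2 * B.+1)); last exact: leq_addl.
apply: (@leq_trans (\sum_(0 <= h < H.+1) g ^ h.+1 * B)).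
  rewrite big_nat [leqRHS]big_nat; apply: leq_sum => h /andP[_ hH].
  apply: sum_pal_mult_large => // z /andP[z0 zk]; apply: tauB; rewrite z0 /=.
  by apply: leq_trans zk _; rewrite leq_exp2l //; lia.
rewrite -big_distrl /=; apply: leq_mul; last exact: leqnSn.
exact: sum_succ_pow_le.
Qed.

(* For [0 < X]: the largest [h] with [g^(2h) <= X]. *)
Definition half_len (g X : nat) : nat := trunc_log (g ^ 2) X.

(* Palindromes of even length are divisible by [g + 1], hence absent. *)
Definition pstar_seq (g X : nat) : seq nat :=
  [seq n <- [seq pal g h a | h <- iota 0 (half_len g X).+1,
                             a <- index_iota (g ^ h) (g ^ h.+1)]
       | (n <= X) && coprime n (g ^ 3 - g)].

Definition pstar_mult (g X d : nat) : nat := \sum_(n <- pstar_seq g X) (d %| n).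

Lemma big_pstar_seq (R : Type) (idx : R) (op : Monoid.com_law idx) (g X : nat)
    (F : nat -> R) :
  \big[op/idx]_(n <- pstar_seq g X) F n =
  \big[op/idx]_(0 <= h < (half_len g X).+1) \big[op/idx]_(g ^ h <= a < g ^ h.+1)
    (if (pal g h a <= X) && coprime (pal g h a) (g ^ 3 - g)
     then F (pal g h a) else idx).
Proof.
rewrite /pstar_seq big_filter big_mkcond big_allpairs_dep /index_iota subn0.
by [].
Qed.

Lemma pstar_mult_le (g X d : nat) :
  pstar_mult g X d <= \sum_(0 <= h < (half_len g X).+1) pal_mult g h d.
Proof.
rewrite /pstar_mult big_pstar_seq; apply: leq_sum => h _.
by apply: leq_sum => a _; case: ifP.
Qed.

Lemma coprime_cube_sub (g n : nat) : 0 < g ->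
  coprime n (g ^ 3 - g) = coprime n g && coprime n (g ^ 2 - 1).
Proof.
move=> g0; rewrite (_ : g ^ 3 - g = g * (g ^ 2 - 1)) ?coprimeMr //.
by rewrite mulnBr muln1 -expnS.
Qed.

Lemma pstar_mult_eq0 (g X d : nat) : 0 < g -> ~~ coprime d (g ^ 3 - g) ->
  pstar_mult g X d = 0.
Proof.
move=> g0 nd; rewrite /pstar_mult big_seq big1 // => n.
rewrite mem_filter => /andP[/andP[_ cn] _].
by case: (boolP (d %| n)) => // dn; rewrite (coprime_dvdl dn cn) in nd.
Qed.

Lemma pal_gt0 (g h a : nat) : 1 < g -> g ^ h <= a < g ^ h.+1 -> 0 < pal g h a.
Proof.
move=> g1 /andP[ha ah]; have /andP[+ _] := pal_bounds g1 ah.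
by apply: leq_trans; rewrite muln_gt0 !(leq_trans _ ha) expn_gt0 ltnW.
Qed.

Lemma mem_pstar_seq (g X n : nat) : 1 < g -> n \in pstar_seq g X -> 0 < n <= X.
Proof.
move=> g1; rewrite mem_filter => /andP[/andP[-> _]] /allpairsPdep[h [a [_]]].
by rewrite mem_index_iota andbT => ha ->; apply: pal_gt0.
Qed.

Lemma pstar_mult_gt (g X d : nat) : 1 < g -> X < d -> pstar_mult g X d = 0.
Proof.
move=> g1 Xd; rewrite /pstar_mult big_seq big1 // => n /(mem_pstar_seq g1)/andP[n0 nX].
by case: (boolP (_ %| _)) => // /(dvdn_leq n0); lia.
Qed.

Lemma half_len_bounds (g X : nat) : 1 < g -> 0 < X ->
  g ^ (2 * half_len g X) <= X < g ^ (2 * (half_len g X).+1).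
Proof.
move=> g1 X0; have g2 : 1 < g ^ 2 by rewrite -(exp1n 2) ltn_exp2r.
by rewrite !expnM trunc_logP ?trunc_log_ltn.
Qed.

Lemma pstar_mult_sq_mean (g : nat) : 1 < g ->
  exists2 C, 0 < C & forall X k, 0 < X ->
    g ^ (k %/ 8) * (\sum_(g ^ k <= d < g ^ k.+1) pstar_mult g X d ^ 2) <=
    C * g ^ (2 * half_len g X).
Proof.
move=> g1; have g0 : 0 < g by apply: ltnW.
have [C C0 HC] := total_mult_mean g1.
exists (2 * g ^ 2 * C) => [|X k X0]; first by rewrite !muln_gt0 g0 C0.
have /andP[_ XH] := half_len_bounds g1 X0; set H := half_len g X in XH *.
(* For such [k] one has [d >= g ^ (2 * H + 2) > X], so nothing is divisible by [d]. *)
have [kH|kH] := ltnP (2 * H).+1 k.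
  rewrite big_nat big1 ?muln0 // => d /andP[kd _].
  rewrite pstar_mult_gt //; apply: leq_trans XH (leq_trans _ kd).
  by rewrite leq_exp2l //; lia.
(* The pointwise gain [g ^ r] pays twice for [g ^ (k %/ 8)]: for the loss in the mean and for the
   factor on the left. *)
set r := k %/ 4; have rk : 4 * r <= k by rewrite mulnC leq_trunc_div.
have ur : 2 * (k %/ 8) <= r by rewrite /r; lia.
apply: (@leq_trans (g ^ (k %/ 8) * (2 * g ^ (H - r).+2 * (C * g ^ (H + k %/ 8))))).
  rewrite leq_mul2l; apply/orP; right.
  apply: leq_trans (_ : _ <= 2 * g ^ (H - r).+2 * \sum_(g ^ k <= d < g ^ k.+1 | coprime d g)
      \sum_(0 <= h < H.+1) pal_mult g h d) _; last by rewrite leq_mul2l HC orbT.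
  rewrite big_distrr /= [leqRHS]big_mkcond /= big_nat [leqRHS]big_nat.
  apply: leq_sum => d /andP[kd _].
  case: (boolP (coprime d g)) => dg; last first.
    rewrite pstar_mult_eq0 // coprime_cube_sub // negb_and dg //.
  rewrite -mulnn; apply: leq_mul; last exact: pstar_mult_le.
  apply: leq_trans (pstar_mult_le g X d) _.
  apply: total_mult_sparse => //; first by lia.
  by apply: leq_trans kd; rewrite leq_exp2l //; lia.
rewrite (_ : _ * _ = 2 * C * g ^ (k %/ 8 + (H - r).+2 + (H + k %/ 8))); last first.
  by rewrite !expnD; ring.
rewrite (_ : 2 * g ^ 2 * C * _ = 2 * C * g ^ (2 + 2 * H)); last by rewrite expnD; ring.
by rewrite leq_mul2l leq_exp2l ?orbT //; lia.
Qed.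

End Moments.

(** * Powers and geometric sums on the unit circle *)

Section UnitCircle.
Variable C : numClosedFieldType.
Implicit Types z : C.

Lemma norm_sum_expr_le (z : C) (n : nat) : `|z| = 1 ->
  `|\sum_(0 <= i < n) z ^+ i| <= n%:R.
Proof.
move=> z1; apply: le_trans (ler_norm_sum _ _ _) _.
under eq_bigr => i _ do rewrite normrX z1 expr1n.
by rewrite big_const_nat subn0 iter_addr_0.
Qed.

Lemma subrX1_nat (z : C) (n : nat) :
  z ^+ n - 1 = (z - 1) * \sum_(0 <= i < n) z ^+ i.
Proof. by rewrite subrX1 big_mkord. Qed.

Lemma norm_exprB1_le (z : C) (n : nat) : `|z| = 1 ->
  `|z ^+ n - 1| <= n%:R * `|z - 1|.
Proof.
move=> z1; rewrite subrX1_nat normrM mulrC ler_wpM2r //.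
exact: norm_sum_expr_le.
Qed.

Lemma norm_sum_exprB_le (z : C) (n : nat) : `|z| = 1 ->
  `|\sum_(0 <= i < n) z ^+ i - n%:R| <= n%:R ^+ 2 * `|z - 1|.
Proof.
move=> z1.
have -> : \sum_(0 <= i < n) z ^+ i - n%:R = \sum_(0 <= i < n) (z ^+ i - 1).
  by rewrite sumrB big_const_nat subn0 iter_addr_0.
apply: le_trans (ler_norm_sum _ _ _) _.
apply: (@le_trans _ _ (\sum_(0 <= i < n) (n%:R * `|z - 1|))); last first.
  by rewrite big_const_nat subn0 iter_addr_0 -[leLHS]mulr_natl mulrA expr2.
rewrite big_nat [leRHS]big_nat; apply: ler_sum => i /andP[_ ii].
apply: le_trans (norm_exprB1_le i z1) _.
by rewrite ler_wpM2r // ler_nat ltnW.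
Qed.

(** Close to 1, the geometric sum in [z ^+ n - 1 = (z - 1) * S] is within [1 / 2] of [n >= 2], so
    taking powers expands the distance to 1. *)
Lemma norm_exprB1_ge (z : C) (n : nat) : (1 < n)%N -> `|z| = 1 ->
  2 * n%:R ^+ 2 * `|z - 1| <= 1 -> 3 / 2 * `|z - 1| <= `|z ^+ n - 1|.
Proof.
move=> n1 z1 small; rewrite subrX1_nat normrM mulrC ler_wpM2l //.
set S := \sum_(_ <= _ < _) _.
have h1 : `|S - n%:R| <= 1 / 2.
  apply: le_trans (norm_sum_exprB_le n z1) _.
  by rewrite ler_pdivlMr // mulrC mulrA.
have h2 : n%:R <= `|S| + `|S - n%:R|.
  rewrite -[X in X <= _](@ger0_norm _ n%:R) // -{1}(subKr S n%:R).
  exact: ler_normB.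
have h3 : 2 <= `|S| + 1 / 2.
  apply: (@le_trans _ _ (n%:R)); first by rewrite (ler_nat _ 2).
  by apply: le_trans h2 _; rewrite lerD2l.
rewrite -(lerD2r (1 / 2)); apply: le_trans h3.
by rewrite (_ : 3 / 2 + 1 / 2 = 2) //; field.
Qed.

Lemma geometric_root_eq0 (z : C) (d : nat) : z ^+ d = 1 -> z != 1 ->
  \sum_(0 <= i < d) z ^+ i = 0.
Proof.
move=> zd zn1; have := subrX1_nat z d; rewrite zd subrr => /esym/eqP.
by rewrite mulf_eq0 subr_eq0 (negPf zn1) => /eqP.
Qed.

(** The geometric sum vanishes, while [norm_sum_exprB_le] places it within [d^2 |z - 1|] of [d]. *)
Lemma root_of_unity_gap (z : C) (d : nat) : (0 < d)%N -> `|z| = 1 ->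
  z ^+ d = 1 -> z != 1 -> 1 <= d%:R * `|z - 1|.
Proof.
move=> d0 z1 zd zn1; have := norm_sum_exprB_le d z1.
rewrite geometric_root_eq0 // sub0r normrN ger0_norm // expr2 -mulrA.
by rewrite -{1}[d%:R]mulr1 ler_pM2l // ltr0n.
Qed.

(* Parallelogram law: [|1 + z|^2 = 4 - |1 - z|^2]. *)
Lemma norm_add1_le (z : C) : `|z| = 1 -> `|1 + z| <= 2 - `|z - 1| ^+ 2 / 4.
Proof.
move=> z1.
have E : `|1 + z| ^+ 2 = 4 - `|z - 1| ^+ 2.
  have zz : z * z^* = 1 by rewrite -normCK z1 expr1n.
  rewrite !normCK !rmorphD rmorphN rmorph1 /=.
  by rewrite mulrDl !mulrDr zz; ring: zz.
have b2 : `|z - 1| ^+ 2 <= 4.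
  by rewrite -subr_ge0 -E exprn_ge0.
have pos : 0 <= 2 - `|z - 1| ^+ 2 / 4.
  rewrite subr_ge0 ler_pdivrMr //; apply: le_trans b2 _.
  by rewrite -natrM ler_nat.
rewrite -(@ler_pXn2r _ 2) ?nnegrE // E -subr_ge0.
set b := `|z - 1| ^+ 2.
have -> : (2 - b / 4) ^+ 2 - (4 - b) = (b / 4) ^+ 2 by field.
by rewrite exprn_ge0 // divr_ge0 // exprn_ge0.
Qed.

(** The saving comes from the terms [1] and [z]; the other [g - 2] are bounded trivially. *)
Lemma norm_digit_sum_le (z : C) (g : nat) : (1 < g)%N -> `|z| = 1 ->
  `|\sum_(0 <= i < g) z ^+ i| <= g%:R - `|z - 1| ^+ 2 / 4.
Proof.
move=> g1 z1; rewrite (big_cat_nat _ (n := 2)) //=.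
rewrite big_nat_recr //= big_nat1 expr0 expr1.
apply: le_trans (ler_normD _ _) _.
have -> : g%:R - `|z - 1| ^+ 2 / 4 = (2 - `|z - 1| ^+ 2 / 4) + (g - 2)%:R :> C.
  by rewrite natrB //; ring.
apply: lerD; first exact: norm_add1_le.
apply: le_trans (ler_norm_sum _ _ _) _.
under eq_bigr => i _ do rewrite normrX z1 expr1n.
by rewrite big_const_nat iter_addr_0.
Qed.

End UnitCircle.

(** * Exponential sums over the central digits *)

Section ExponentialSums.
Variable C : numClosedFieldType.

(* With [t = 1 / (2 g^2 (g+1))], every window contains a digit whose exponential
   sum is at most [g - t^2 / 4 = g (1 - 1 / window_den g)]. *)
Definition window_den (g : nat) : nat := (16 * g ^ 5 * g.+1 ^ 2)%N.

Lemma window_den_gt0 (g : nat) : (1 < g)%N -> (0 < window_den g)%N.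
Proof. by move=> g1; rewrite /window_den !muln_gt0 (ltnW g1). Qed.

Lemma block_char_sum (g h r : nat) (z : C) : (1 < g)%N ->
  \sum_(0 <= e < g ^ r) z ^+ block g h 0 r e =
  \prod_(0 <= i < r) \sum_(0 <= a < g) (z ^+ weight g h i) ^+ a.
Proof.
move=> g1; elim: r => [|r IH].
  by rewrite expn0 big_nat1 /block !big_geq // expr0.
rewrite big_nat_recr //= -IH expnS big_nat0_muln mulrC big_distrl /=.
rewrite big_nat [RHS]big_nat; apply: eq_bigr => a /andP[_ ag].
rewrite big_distrr /= big_nat [RHS]big_nat.
apply: eq_bigr => e /andP[_ er].
rewrite -[in LHS]addn1 block_split // exprD mulrC -exprM; congr (z ^+ _ * _).
rewrite /block big_nat1 /digit expn0 divn1 modn_small // mulnC addn0.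
by rewrite add0n.
Qed.

(* On a window where every [z ^+ weight g h i] is close to 1, the numbers
   [z ^+ ((g^2-1) g^(h+i-1))] are close to 1 too, because
   [g * weight i - weight (i-1) = (g^2-1) g^(h+i-1)]; but each is the g-th power
   of the preceding one, so their distance to 1 grows geometrically. *)
Lemma window_large (g h d s i0 : nat) (z : C) : (1 < g)%N -> `|z| = 1 ->
  (0 < d)%N -> (0 < i0)%N -> (i0 + s.+1 <= h)%N ->
  (forall j, (0 < j)%N -> z ^+ ((g ^ 2 - 1) * g ^ j) != 1 /\
                          (z ^+ ((g ^ 2 - 1) * g ^ j)) ^+ d = 1) ->
  d%:R <= (3 / 2) ^+ s :> C ->
  exists2 i, (i0 <= i <= i0 + s.+1)%N &
    ~~ (2 * g%:R ^+ 2 * (g.+1)%:R * `|z ^+ weight g h i - 1| <= 1).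
Proof.
move=> g1 z1 d0 i00 ih hv ds.
case: (boolP [forall i : 'I_s.+2, 2 * g%:R ^+ 2 * (g.+1)%:R *
     `|z ^+ weight g h (i0 + i) - 1| <= 1]); last first.
  rewrite negb_forall => /existsP[i Hi]; exists (i0 + i)%N => //.
  by rewrite leq_addr leq_add2l -ltnS ltn_ord.
move=> /forallP close; exfalso.
pose v i := z ^+ ((g ^ 2 - 1) * g ^ (h + (i0 + i))).
have v1 i : `|v i| = 1 by rewrite /v normrX z1 expr1n.
have vS i : v i.+1 = v i ^+ g.
  by rewrite /v -exprM !addnS (expnS g (h + (i0 + i))) mulnCA mulnC.
have vsmall i : (i <= s)%N -> 2 * g%:R ^+ 2 * `|v i - 1| <= 1.
  move=> is_; set w := fun k => z ^+ weight g h (i0 + k).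
  have w1 k : `|w k| = 1 by rewrite /w normrX z1 expr1n.
  have E : v i * w i = w i.+1 ^+ g.
    rewrite /v /w -exprM -exprD; congr (_ ^+ _); rewrite /weight.
    have -> : (i0 + i == 0)%N = false by lia.
    have -> : (i0 + i.+1 == 0)%N = false by lia.
    have -> : (h - (i0 + i) = (h - (i0 + i.+1)).+1)%N by lia.
    have -> : (h + (i0 + i.+1) = (h + (i0 + i)).+1)%N by lia.
    rewrite mulnDl -!expnSr !(expnS g) expn0 muln1.
    have : (0 < g * g)%N by rewrite muln_gt0; lia.
    set a := (g ^ (h + _))%N; set b := (g ^ (h - _))%N.
    rewrite mulnBl mul1n => gg.
    have : (a <= g * g * a)%N by rewrite leq_pmull.
    by rewrite mulnA; lia.
  have h1 : `|v i - 1| <= `|w i.+1 ^+ g - 1| + `|w i - 1|.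
    have -> : `|v i - 1| = `|(v i - 1) * w i| by rewrite normrM w1 mulr1.
    rewrite mulrBl E mul1r.
    have -> : w i.+1 ^+ g - w i = (w i.+1 ^+ g - 1) - (w i - 1) by ring.
    exact: ler_normB.
  have h2 := norm_exprB1_le g (w1 i.+1).
  have is1 : (i.+1 < s.+2)%N by [].
  have is2 : (i < s.+2)%N by apply: ltnW.
  have c1 := close (Ordinal is1); have c2 := close (Ordinal is2).
  rewrite /= -/(w _) in c1 c2.
  set T := 2 * g%:R ^+ 2 in c1 c2 *.
  have T0 : 0 <= T by rewrite mulr_ge0 // exprn_ge0.
  have gS : 0 < (g.+1)%:R :> C by rewrite ltr0n.
  rewrite -(ler_pM2r gS) mul1r.
  apply: (@le_trans _ _ (T * (g%:R * `|w i.+1 - 1| + `|w i - 1|) * g.+1%:R)).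
    rewrite ler_wpM2r ?ler0n // ler_wpM2l //; apply: le_trans h1 _.
    by rewrite lerD2r.
  have -> : T * (g%:R * `|w i.+1 - 1| + `|w i - 1|) * g.+1%:R =
     g%:R * (T * g.+1%:R * `|w i.+1 - 1|) + T * g.+1%:R * `|w i - 1| by ring.
  rewrite [leRHS](_ : _ = g%:R + 1); last by rewrite -addn1 natrD.
  by apply: lerD => //; rewrite -[leRHS]mulr1 ler_wpM2l ?ler0n.
have grow i : (i <= s)%N -> (3 / 2) ^+ i * `|v 0%N - 1| <= `|v i - 1|.
  elim: i => [|i IH] si; first by rewrite expr0 mul1r.
  rewrite exprS -mulrA vS.
  apply: le_trans (norm_exprB1_ge g1 (v1 i) (vsmall i (ltnW si))).
  by rewrite ler_wpM2l ?divr_ge0 // IH // ltnW.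
(* [v 0] is a nontrivial [d]-th root of unity, at distance at least [1 / d] from 1. After [s] steps
   of growth, [(3 / 2) ^ s >= d] makes the distance at least 1, against [vsmall]. *)
have [vn1 vd] := hv (h + (i0 + 0))%N ltac:(lia).
have gap := root_of_unity_gap d0 (v1 0%N) vd vn1.
have h1 : 1 <= `|v s - 1|.
  apply: le_trans gap (le_trans _ (grow s (leqnn s))).
  by rewrite ler_wpM2r.
have : 2 * g%:R ^+ 2 <= 1 :> C.
  apply: le_trans (vsmall s (leqnn s)).
  by rewrite -[leLHS]mulr1 ler_wpM2l // mulr_ge0 // exprn_ge0.
rewrite -natrX -natrM (ler_nat _ _ 1) leqNgt => /negP; apply.
by rewrite (@leq_ltn_trans (2 * 1)%N) // ltn_mul2l /= -(exp1n 2) ltn_exp2r.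
Qed.

Lemma window_small (g h d s i0 : nat) (z : C) : (1 < g)%N -> `|z| = 1 ->
  (0 < d)%N -> (0 < i0)%N -> (i0 + s.+1 <= h)%N ->
  (forall j, (0 < j)%N -> z ^+ ((g ^ 2 - 1) * g ^ j) != 1 /\
                          (z ^+ ((g ^ 2 - 1) * g ^ j)) ^+ d = 1) ->
  d%:R <= (3 / 2) ^+ s :> C ->
  exists2 i, (i0 <= i <= i0 + s.+1)%N &
    (window_den g)%:R * `|\sum_(0 <= a < g) (z ^+ weight g h i) ^+ a| <=
      g%:R * (window_den g).-1%:R.
Proof.
move=> g1 z1 d0 i00 ih hv ds.
have [i ii Hi] := window_large g1 z1 d0 i00 ih hv ds; exists i => //.
set w := z ^+ weight g h i in Hi *.
have w1 : `|w| = 1 by rewrite /w normrX z1 expr1n.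
set T := 2 * g%:R ^+ 2 * _ in Hi.
have T0 : 0 <= T by rewrite !mulr_ge0 // exprn_ge0.
have T1 : 1 < T * `|w - 1|.
  by rewrite real_ltNge ?realE ?ler01 // mulr_ge0.
have T2 : 1 <= T ^+ 2 * `|w - 1| ^+ 2 by rewrite -exprMn exprn_ege1 // ltW.
have K0 := window_den_gt0 g1.
have KE : (window_den g)%:R = 4 * g%:R * T ^+ 2 :> C.
  by rewrite /window_den /T !natrM ?natrX; ring.
apply: le_trans (ler_wpM2l _ (norm_digit_sum_le g1 w1)) _ => //.
rewrite -subn1 natrB // !mulrBr mulr1 [_ * g%:R]mulrC lerD2l lerN2.
rewrite KE (_ : 4 * g%:R * T ^+ 2 * (`|w - 1| ^+ 2 / 4) =
                g%:R * (T ^+ 2 * `|w - 1| ^+ 2)); last by field.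
by rewrite -[leLHS]mulr1 ler_wpM2l.
Qed.

Lemma prod_nat_le_exp (G : C) (F : nat -> C) (m n : nat) :
  (forall i, 0 <= F i <= G) ->
  0 <= \prod_(m <= i < n) F i <= G ^+ (n - m).
Proof.
move=> FG; apply/andP; split.
  by apply: prodr_ge0 => i _; case/andP: (FG i).
apply: (@le_trans _ _ (\prod_(m <= i < n) G)).
  by apply: ler_prod => i _; exact: FG.
by rewrite big_const_nat iter_mulr_1.
Qed.

(** The outermost [s.+2] digits of the box form a window that saves one factor [(K - 1) / K] with
    [K = window_den g]; the induction on [j] goes on with the remaining digits. The strict
    [j * s.+2 < r] keeps all windows off the central digit, whose weight is a single power of
    [g]. *)
Lemma norm_block_char_sum_le (g h d s j r : nat) (z : C) : (1 < g)%N -> `|z| = 1 ->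
  (0 < d)%N -> (j * s.+2 < r <= h.+1)%N ->
  (forall j, (0 < j)%N -> z ^+ ((g ^ 2 - 1) * g ^ j) != 1 /\
                          (z ^+ ((g ^ 2 - 1) * g ^ j)) ^+ d = 1) ->
  d%:R <= (3 / 2) ^+ s :> C ->
  (window_den g)%:R ^+ j * `|\sum_(0 <= e < g ^ r) z ^+ block g h 0 r e| <=
    g%:R ^+ r * (window_den g).-1%:R ^+ j.
Proof.
move=> g1 z1 d0 jr hv ds; rewrite block_char_sum // normr_prod.
pose F i := `|\sum_(0 <= a < g) (z ^+ weight g h i) ^+ a|.
have FG i : 0 <= F i <= g%:R.
  by rewrite /F normr_ge0 norm_sum_expr_le // normrX z1 expr1n.
have PG m n := prod_nat_le_exp m n FG.
rewrite -/F; elim: j r jr => [|j IH] r /andP[jr rh].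
  by rewrite !expr0 mul1r mulr1; have /andP[_] := PG 0%N r; rewrite subn0.
set i0 := (r - s.+2)%N.
have jr' : (j * s.+2 < i0)%N by rewrite /i0 ltn_subRL; lia.
have i00 : (0 < i0)%N by apply: leq_ltn_trans jr'.
have ih : (i0 + s.+1 <= h)%N by rewrite /i0; lia.
have [i /andP[i0i ii] Fi] := window_small g1 z1 d0 i00 ih hv ds.
have jr2 : (j * s.+2 < i0 <= h.+1)%N by rewrite jr' /=; lia.
rewrite (big_cat_nat _ (n := i0)) ?leq_subr //= !exprS.
have iE : (i0 + s.+1)%N = r.-1 by rewrite /i0; lia.
rewrite [X in _ * (_ * X)](big_cat_nat _ (n := i)) //=; last by lia.
rewrite [X in _ * (_ * (_ * X))]big_ltn; last by lia.
have /andP[A0 A1] := PG i0 i; have /andP[B0 B1] := PG i.+1 r.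
have /andP[F0 _] := FG i; have /andP[P0 _] := PG 0%N i0.
set P := \prod_(0 <= k < i0) _ in P0 *; set A := \prod_(i0 <= k < i) _ in A0 A1 *.
set B := \prod_(i.+1 <= k < r) _ in B0 B1 *.
set K := (window_den g)%:R; set K1 := (window_den g).-1%:R.
have rE : r = (i0 + ((i - i0) + 1 + (r - i.+1)))%N by rewrite /i0; lia.
have -> : K * K ^+ j * (P * (A * (F i * B))) =
  (K ^+ j * P) * (A * (K * F i) * B) by ring.
have -> : g%:R ^+ r * (K1 * K1 ^+ j) = (g%:R ^+ i0 * K1 ^+ j) *
   (g%:R ^+ (i - i0) * (g%:R * K1) * g%:R ^+ (r - i.+1)).
  by rewrite {1}rE !exprD expr1; ring.
apply: ler_pM; rewrite ?mulr_ge0 ?exprn_ge0 ?ler0n //; first exact: IH.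
by do 2 (apply: ler_pM; rewrite ?mulr_ge0 ?ler0n //).
Qed.

Lemma coprime_root1 (z : C) (m n : nat) : (0 < m)%N -> coprime m n ->
  z ^+ m = 1 -> z ^+ n = 1 -> z = 1.
Proof.
move=> m0 mn zm zn; have [k kz km] := prim_order_exists m0 zm.
have kn : (k %| n)%N by rewrite (prim_order_dvd kz) zn.
have : (k %| gcdn m n)%N by rewrite dvdn_gcd km kn.
rewrite (eqP mn) dvdn1 => /eqP k1; rewrite k1 in kz.
by have := prim_expr_order kz; rewrite expr1.
Qed.

Lemma sum_roots_indicator (d n : nat) (w : C) : d.-primitive_root w ->
  \sum_(0 <= a < d) (w ^+ a) ^+ n = d%:R * (d %| n)%:R.
Proof.
move=> wd; under eq_bigr => a _ do rewrite exprAC.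
rewrite (prim_order_dvd wd); case: eqVneq => [->|wn1].
  under eq_bigr => a _ do rewrite expr1n.
  by rewrite big_const_nat subn0 iter_addr_0 mulr1.
by rewrite mulr0 geometric_root_eq0 // exprAC (prim_expr_order wd) expr1n.
Qed.

End ExponentialSums.

(* Both indicators are expanded in additive characters; the terms trivial
   modulo [d] add up to the count without the divisibility condition. *)
Lemma equidistribution_of_char_sums (d M n : nat) (f : nat -> nat) (B : algC) :
  (0 < d)%N -> (0 < M)%N -> 0 <= B ->
  (forall x y : algC, `|x| = 1 -> `|y| = 1 -> x ^+ d = 1 -> x != 1 -> y ^+ M = 1 ->
     `|\sum_(0 <= e < n) (x * y) ^+ f e| <= B) ->
  `|d%:R * (\sum_(0 <= e < n) ((d %| f e) && coprime (f e) M))%:R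
    - (\sum_(0 <= e < n) coprime (f e) M)%:R| <= d%:R * M%:R * B.
Proof.
move=> d0 M0 B0 HB.
have [w wd] := C_prim_root_exists d0; have [y yM] := C_prim_root_exists M0.
have root1 (k m : nat) (x : algC) : (0 < m)%N -> x ^+ m = 1 -> `|x ^+ k| = 1.
  move=> m0 xm; rewrite normrX; apply/eqP.
  have : `|x| ^+ m == 1 by rewrite -normrX xm normr1.
  by rewrite pexpr_eq1 ?normr_ge0 // => /eqP->; rewrite expr1n.
(* Coprimality to [M] is the union of the reduced residue classes [u]; [M - u] stands for [-u] in
   the exponent. *)
have ind e : M%:R * (coprime (f e) M)%:R =
   \sum_(0 <= u < M | coprime u M) \sum_(0 <= b < M) (y ^+ b) ^+ (f e + (M - u)).
  under eq_bigr => u _ do rewrite (sum_roots_indicator _ yM).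
  rewrite -big_distrr /=; congr (_ * _).
  have vM : (f e %% M < M)%N by rewrite ltn_pmod.
  rewrite big_mkcond /= (@bigD1_seq _ _ _ _ _ (f e %% M)%N) ?iota_uniq ?mem_index_iota //=.
  rewrite coprime_modl big_nat_cond big1 ?addr0 => [|u].
    case: ifP => // _; rewrite {1}(divn_eq (f e) M) -addnA subnKC ?(ltnW vM) //.
    by rewrite dvdn_add ?dvdn_mull.
  move=> /andP[/andP[_ uM] ne]; case: ifP => // _.
  case: (boolP (_ %| _)%N) => // dv; case/eqP: ne.
  have : (f e + (M - u) == u + (M - u) %[mod M])%N.
    by rewrite subnKC ?(ltnW uM) // modnn; exact: dv.
  by rewrite eqn_modDr => /eqP->; rewrite modn_small.
have main : M%:R * (d%:R * (\sum_(0 <= e < n) ((d %| f e) && coprime (f e) M))%:R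
    - (\sum_(0 <= e < n) coprime (f e) M)%:R) =
   \sum_(0 <= u < M | coprime u M) \sum_(0 <= b < M) \sum_(1 <= a < d)
     (y ^+ b) ^+ (M - u) * \sum_(0 <= e < n) (w ^+ a * y ^+ b) ^+ f e.
  rewrite !natr_sum big_distrr -sumrB big_distrr /=.
  transitivity (\sum_(0 <= e < n) (\sum_(1 <= a < d) (w ^+ a) ^+ f e) *
     (\sum_(0 <= u < M | coprime u M) \sum_(0 <= b < M) (y ^+ b) ^+ (f e + (M - u)))).
    apply: eq_bigr => e _; rewrite -ind.
    have := sum_roots_indicator (f e) wd; rewrite big_ltn // expr0 expr1n => E.
    have -> : \sum_(1 <= a < d) (w ^+ a) ^+ f e = d%:R * (d %| f e)%:R - 1.
      by rewrite -E addrC addKr.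
    by rewrite -mulnb natrM; ring.
  under [LHS]eq_bigr => e _ do rewrite mulr_sumr.
  rewrite [LHS]exchange_big /=; apply: eq_bigr => u _.
  under [LHS]eq_bigr => e _ do rewrite mulr_sumr.
  rewrite [LHS]exchange_big /=; apply: eq_bigr => b _.
  under [LHS]eq_bigr => e _ do rewrite mulr_suml.
  rewrite [LHS]exchange_big /=; apply: eq_bigr => a _.
  rewrite mulr_sumr; apply: eq_bigr => e _.
  by rewrite exprMn exprD; ring.
have M0' : 0 < M%:R :> algC by rewrite ltr0n.
rewrite -(ler_pM2l M0') -{1}(ger0_norm (ltW M0')) -normrM main.
apply: le_trans (ler_norm_sum _ _ _) _.
apply: (@le_trans _ _ (\sum_(0 <= u < M) M%:R * (d%:R * B))); last first.
  rewrite big_const_nat subn0 iter_addr_0 -[leLHS]mulr_natl.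
  by rewrite le_eqVlt; apply/orP; left; apply/eqP; ring.
rewrite big_mkcond /=; apply: ler_sum => u _; case: ifP => _; last first.
  by rewrite !mulr_ge0 ?ler0n.
apply: le_trans (ler_norm_sum _ _ _) _.
apply: (@le_trans _ _ (\sum_(0 <= b < M) d%:R * B)); last first.
  by rewrite big_const_nat subn0 iter_addr_0 -[leLHS]mulr_natl.
apply: ler_sum => b _; apply: le_trans (ler_norm_sum _ _ _) _.
apply: (@le_trans _ _ (\sum_(1 <= a < d) B)); last first.
  by rewrite big_const_nat iter_addr_0 -[leLHS]mulr_natl ler_wpM2r // ler_nat leq_subr.
rewrite big_nat [leRHS]big_nat; apply: ler_sum => a /andP[a0 ad].
have yb1 := root1 b M y M0 (prim_expr_order yM).
rewrite normrM normrX yb1 expr1n mul1r; apply: HB => //.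
- exact: root1 (prim_expr_order wd).
- by rewrite exprAC (prim_expr_order wd) expr1n.
- by rewrite -(prim_order_dvd wd) gtnNdvd.
- by rewrite exprAC (prim_expr_order yM) expr1n.
Qed.

(** * Equidistribution modulo [d] inside one box *)

Section BoxEquidistribution.
Local Open Scope nat_scope.

(** The characters are [z = x * y] with [x] a nontrivial [d]-th root of unity and [y ^ M = 1]. For
    [i > 0] the exponent [(g ^ 2 - 1) * g ^ i] is a multiple of [M = g ^ 3 - g], which kills [y],
    and is coprime to [d], which keeps [x] nontrivial: the hypothesis of the window lemmas. *)
Lemma box_equidistribution (g h d s j r c : nat) : 1 < g -> 0 < d ->
  coprime d (g ^ 3 - g) -> j * s.+2 < r <= h.+1 -> d * 2 ^ s <= 3 ^ s ->
  let K := window_den g in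
  let f := fun e => block g h 0 r e + c in
  let E := \sum_(0 <= e < g ^ r) ((d %| f e) && coprime (f e) (g ^ 3 - g)) in
  let E1 := \sum_(0 <= e < g ^ r) coprime (f e) (g ^ 3 - g) in
  let err := d * (g ^ 3 - g) * (g ^ r * K.-1 ^ j) in
  K ^ j * (d * E) <= K ^ j * E1 + err /\ K ^ j * E1 <= K ^ j * (d * E) + err.
Proof.
move=> g1 d0 dM jr ds K f E E1 err; set M := g ^ 3 - g in dM E E1 err *.
have M0 : 0 < M by rewrite subn_gt0 -{1}(expn1 g) ltn_exp2l.
have K0 : (0 < K%:R ^+ j :> algC)%R.
  by rewrite exprn_gt0 // ltr0n window_den_gt0.
have ds' : (d%:R <= (3 / 2) ^+ s :> algC)%R.
  rewrite expr_div_n ler_pdivlMr ?exprn_gt0 // -!natrX -natrM ler_nat //.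
have B0 : (0 <= g%:R ^+ r * K.-1%:R ^+ j / K%:R ^+ j :> algC)%R.
  by rewrite divr_ge0 ?mulr_ge0 ?exprn_ge0 // ler0n.
have := @equidistribution_of_char_sums d M (g ^ r) f _ d0 M0 B0.
have Mj i : 0 < i -> (g ^ 2 - 1) * g ^ i = M * g ^ i.-1.
  case: i => // i _; rewrite (expnS g i) mulnA; congr (_ * _).
  by rewrite /M mulnBl mul1n -expnSr.
rewrite -/E -/E1; set P := (forall x y : algC, _) => key.
have HP : P.
  rewrite /P => x y x1 y1 xd xn1 yM.
  under eq_bigr => e _ do rewrite /f exprD.
  rewrite -big_distrl normrM [X in (_ * X)%R]normrX normrM x1 y1 mul1r expr1n mulr1.
  rewrite ler_pdivlMr // mulrC; apply: norm_block_char_sum_le ds' => //.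
    by rewrite normrM x1 y1 mul1r.
  move=> i i0; rewrite Mj //.
  have yE : (y ^+ (M * g ^ i.-1) = 1)%R by rewrite exprM yM expr1n.
  rewrite exprMn yE mulr1; split; last by rewrite exprAC xd expr1n.
  apply/eqP => xE; case/eqP: xn1; apply: coprime_root1 xd xE => //.
  rewrite coprimeMr dM coprimeXr //.
  by move: dM; rewrite /M coprime_cube_sub ?(ltnW g1) // => /andP[].
move: (key HP) => {key HP P}.
have errE : (d%:R * M%:R * (g%:R ^+ r * K.-1%:R ^+ j / K%:R ^+ j) =
    err%:R / K%:R ^+ j :> algC)%R.
  by rewrite /err !natrM !natrX !mulrA.
rewrite errE; clearbody err.
rewrite ler_pdivlMr // -{1}(ger0_norm (ltW K0)) -normrM.
have real_e : ((d%:R * E%:R - E1%:R) * K%:R ^+ j)%R \is (@Num.real algC).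
  by rewrite rpredM ?rpredB ?rpredM ?rpredX ?realn.
rewrite real_ler_norml // => /andP[h1 h2].
split; rewrite -(ler_nat algC) natrD !natrM natrX.
  rewrite -lerBlDl -mulrBr mulrC; exact: h2.
rewrite -lerBlDl -mulrBr mulrC -lerN2 -mulNr opprB; exact: h1.
Qed.

End BoxEquidistribution.

(** * Palindromes coprime to [g^3 - g] have positive proportion *)

Section LowerBound.
Local Open Scope nat_scope.

Lemma coprime_sqr_sub1 (g : nat) : 1 < g -> coprime g (g ^ 2 - 1).
Proof.
move=> g1; rewrite coprime_sym -(coprime_pexpr _ g (isT : 0 < 2)) subn1 coprimePn //.
by rewrite expn_gt0 ltnW.
Qed.

(** The leading digit is 1, hence so is the last one, and the palindrome is 1 modulo [g]. *)
Lemma pal_coprime_base (g h a : nat) : 1 < g -> 0 < h -> g ^ h <= a < 2 * g ^ h ->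
  coprime (pal g h a) g.
Proof.
move=> g1 h0 /andP[ha ah].
have ah' : a < g ^ h.+1 by apply: leq_trans ah _; rewrite expnS leq_mul2r g1 orbT.
have gh : 0 < g ^ h by rewrite expn_gt0 ltnW.
have a1 : digit g a h = 1.
  rewrite /digit (_ : a %/ g ^ h = 1) ?modn_small //.
  by apply/eqP; rewrite eqn_leq leq_divRL // mul1n ha -ltnS ltn_divLR // ah.
rewrite /pal blockE // /block_rev big_nat_recr //= a1 mul1n add0n.
rewrite (gtn_eqF h0) subnn expn0 addnA.
suff /dvdnP[q ->] : g %| a * g ^ (h + 0) +
   \sum_(0 <= i < h) digit g a i * (if 0 + i == 0 then 0 else g ^ (h - (0 + i))).
  by rewrite -coprime_modl modnMDl coprime_modl coprime1n.
apply: dvdn_add; first by rewrite addn0 dvdn_mull // dvdn_exp.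
rewrite big_nat; apply: dvdn_sum => i /andP[_ ih]; apply: dvdn_mull.
by case: eqP => // _; rewrite dvdn_exp // subn_gt0.
Qed.

Lemma sqr_Zp (g : nat) : 1 < g -> (g%:R ^+ 2 = 1 :> 'Z_(g ^ 2 - 1))%R.
Proof.
move=> g1; have g2 : 3 < g ^ 2 by rewrite (leq_exp2r 2 g (isT : 0 < 2)).
have gE : g ^ 2 = (g ^ 2 - 1) + 1 by lia.
have N1 : 1 < g ^ 2 - 1 by lia.
move: (g ^ 2 - 1) gE N1 => N gE N1.
by rewrite -natrX gE natrD pchar_Zp ?add0r.
Qed.

Lemma weight_Zp (g h i : nat) : 1 < g -> 0 < i <= h ->
  ((weight g h i)%:R = 2 * g%:R ^+ (h - i) :> 'Z_(g ^ 2 - 1))%R.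
Proof.
move=> g1 /andP[i0 ih]; rewrite /weight; have -> : (i == 0) = false by lia.
have g2 : 3 < g ^ 2 by rewrite (leq_exp2r 2 g (isT : 0 < 2)).
have G2 := sqr_Zp g1.
have -> : h + i = 2 * i + (h - i) by lia.
by rewrite natrD !natrX exprD exprM G2 expr1n; ring.
Qed.

Lemma block1 (g h s x : nat) : x < g -> block g h s 1 x = x * weight g h s.
Proof. by move=> xg; rewrite /block big_nat1 /digit divn1 modn_small // addn0. Qed.

(* The two digits next to the centre shift the value by
   [2 g^(h-2) (g u + v)] modulo [g^2 - 1], which runs over twice all residues. *)
Lemma box_has_unit (g h b : nat) : 1 < g -> 2 < h ->
  exists2 e, e < g ^ 3 &
    coprime (block g h 0 3 e + block g h 3 (h.+1 - 3) b) (g ^ 2 - 1).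
Proof.
move=> g1 h2; set N := g ^ 2 - 1.
have g2 : 3 < g ^ 2 by rewrite (leq_exp2r 2 g (isT : 0 < 2)).
have N1 : 1 < N by rewrite /N; lia.
pose c' := \sum_(0 <= i < h.+1 - 3) digit g b i * g ^ (h - (3 + i)).
(* [N - 1] plays [-1]. As [g ^ 2 = 1] modulo [N], the shift by the digits [u], [v] of [y] cancels
   the contribution [2 * c'] of the outer digits; there remains the central digit 1 with weight
   [g ^ h], a unit modulo [N]. *)
pose y := (g ^ (h - 2) * (c' * (N - 1))) %% N.
have yN : y < N by rewrite ltn_pmod // ltnW.
have v_g : y %% g < g by rewrite ltn_pmod // ltnW.
have u_g : y %/ g < g.
  by rewrite ltn_divLR ?(ltnW g1) // mulnn; apply: leq_trans yN (leq_subr _ _).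
set u := y %/ g in u_g; set v := y %% g in v_g.
have w1 : v * g ^ 1 + u < g ^ 2.
  rewrite expn1 (expnS g 1) expn1; nia.
exists ((v * g ^ 1 + u) * g ^ 1 + 1); first by rewrite (expnS g 2) expn1; nia.
rewrite (@block_split g h 0 1 2) ?expn1 // -{3}(expn1 g) (@block_split g h 1 1 1) ?expn1 //.
rewrite !block1 // mul1n; set c := block _ _ _ _ b.
set n := _ + c.
pose G : 'Z_N := (g%:R)%R.
have G2 : (G ^+ 2 = 1)%R := sqr_Zp g1.
have cE : (c%:R = 2 * c'%:R :> 'Z_N)%R.
  rewrite /c /c' /block !natr_sum mulr_sumr big_nat [RHS]big_nat.
  apply: eq_bigr => i /andP[_ ih]; rewrite !natrM weight_Zp ?natrX //; last by lia.
  by ring.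
have yE : (y%:R = G ^+ (h - 2) * (- c'%:R))%R.
  rewrite /y Zp_nat_mod // !natrM natrX natrB ?(ltnW N1) // pchar_Zp //.
  by rewrite sub0r mulrN1.
have nE : (n%:R = (g ^ h)%:R :> 'Z_N)%R.
  rewrite /n !natrD !natrM cE (@weight_Zp g h 1) ?(@weight_Zp g h (1 + 1)) //;
    try lia.
  have -> : h - 1 = (h - 2).+1 by lia.
  have yuv : (y%:R = u%:R * G + v%:R :> 'Z_N)%R.
    by rewrite {1}(divn_eq y g) natrD natrM.
  rewrite exprS -/G /weight /=.
  have -> : (u%:R * (2 * (G * G ^+ (h - 2))) + v%:R * (2 * G ^+ (h - 2)) =
             2 * G ^+ (h - 2) * y%:R)%R by rewrite yuv; ring.
  rewrite yE -!mulrA (mulrA (G ^+ (h - 2))) -exprD addnn -mul2n exprM G2 expr1n.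
  by rewrite mul1r mulrN -addrA addNr addr0.
have : n %% N = g ^ h %% N by rewrite -!(val_Zp_nat N1) nE.
rewrite -coprime_modl => ->; rewrite coprime_modl coprimeXl //.
exact: coprime_sqr_sub1.
Qed.

(** Palindromes with [2 * H - 1] digits, two fewer than the maximal length, all lie below [X]. Those
    with leading digit 1 fill [g ^ (H - 4)] boxes of three central digits, and [box_has_unit] finds
    one admissible element in each. For [H <= 3] the palindrome 1 suffices. *)
Lemma pstar_mult1_ge (g X : nat) : 1 < g -> 0 < X ->
  g ^ half_len g X <= g ^ 4 * pstar_mult g X 1.
Proof.
move=> g1 X0; have /andP[HX _] := half_len_bounds g1 X0.
have g0 : 0 < g by apply: ltnW.
rewrite /pstar_mult big_pstar_seq; move: HX; set H := half_len g X => HX.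
have gX : 0 < g ^ 3 - g by rewrite subn_gt0 -{1}(expn1 g) ltn_exp2l.
have [H4|H4] := leqP H 3.
  apply: (@leq_trans (g ^ 4 * 1)); first by rewrite muln1 leq_exp2l //; lia.
  rewrite leq_mul2l; apply/orP; right; rewrite big_ltn // expn0 expn1.
  apply: leq_trans (leq_addr _ _); rewrite big_ltn //.
  have -> : pal g 0 1 = 1 by rewrite /pal block1 // mul1n.
  by rewrite X0 coprime1n.
have [h hE] : exists h, H = h.+1 by exists H.-1; lia.
rewrite hE in HX H4 *; have h2 : 2 < h by lia.
have h3 : 3 <= h by lia.
rewrite big_nat_recr // big_nat_recr //=.
apply: (@leq_trans (g ^ 4 * g ^ (h - 3))).
  by rewrite -expnD leq_exp2l //; lia.
rewrite leq_mul2l; apply/orP; right; rewrite -addnA; apply: leq_trans (leq_addl _ _).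
apply: leq_trans (leq_addr _ _).
rewrite (sum_pal_boxes (fun n => if (n <= X) && coprime n (g ^ 3 - g)
                                 then nat_of_bool (1 %| n) else 0) g1 h3).
have lt2 : 2 * g ^ (h - 3) <= g ^ (h - 3).+1 by rewrite expnS leq_mul2r g1 orbT.
rewrite (big_cat_nat _ (n := 2 * g ^ (h - 3))) ?leq_pmull //=.
apply: leq_trans (leq_addr _ _).
apply: (@leq_trans (\sum_(g ^ (h - 3) <= b < 2 * g ^ (h - 3)) 1)).
  by rewrite sum_nat_const_nat muln1 mul2n -addnn addnK.
rewrite big_nat [leqRHS]big_nat; apply: leq_sum => b /andP[hb bh].
have [e eg eN] := box_has_unit b g1 h2.
rewrite (bigD1_seq e) ?iota_uniq ?mem_index_iota //= dvd1n.
apply: leq_trans (leq_addr _ _).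
rewrite coprime_cube_sub // eN andbT -pal_split //.
have gh3 : g ^ h = g ^ (h - 3) * g ^ 3 by rewrite -expnD subnK.
have a1 : g ^ h <= b * g ^ 3 + e.
  by rewrite gh3; apply: leq_trans (leq_addr _ _); rewrite leq_mul2r hb orbT.
have a2 : b * g ^ 3 + e < 2 * g ^ h.
  rewrite gh3 mulnA; apply: (@leq_trans (b.+1 * g ^ 3)).
    by rewrite mulSn addnC ltn_add2r.
  by rewrite leq_mul2r bh orbT.
have a3 : b * g ^ 3 + e < g ^ h.+1.
  by apply: leq_trans a2 _; rewrite expnS leq_mul2r g1 orbT.
rewrite pal_coprime_base ?a1 ?a2 //; last by lia.
rewrite (leq_trans (ltnW (pal_ltX g1 a3))) //.
by apply: leq_trans HX; rewrite leq_exp2l //; lia.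
Qed.

End LowerBound.

(** * Equidistribution modulo [d] among all admissible palindromes up to [X] *)

Section Equidistribution.
Local Open Scope nat_scope.

(** [|a - b| <= e], avoiding truncated subtraction. *)
Definition within (a b e : nat) : Prop := a <= b + e /\ b <= a + e.

Lemma within_sum (m n : nat) (a b e : nat -> nat) :
  (forall i, m <= i < n -> within (a i) (b i) (e i)) ->
  within (\sum_(m <= i < n) a i) (\sum_(m <= i < n) b i) (\sum_(m <= i < n) e i).
Proof.
move=> H; split; rewrite -big_split /= big_nat [leqRHS]big_nat;
by apply: leq_sum => i /H[].
Qed.

Lemma within_le (a b e e' : nat) : e <= e' -> within a b e -> within a b e'.
Proof. by move=> ee [h1 h2]; split; lia. Qed.

Lemma within_triv (k d n a b : nat) : 0 < d -> a <= n -> b <= n ->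
  within (k * (d * a)) (k * b) (k * (d * n)).
Proof.
move=> d0 an bn; split.
  by apply: leq_trans (leq_addl _ _); rewrite !leq_mul2l an !orbT.
apply: leq_trans (leq_addl _ _); rewrite leq_mul2l; apply/orP; right.
by apply: leq_trans bn _; rewrite leq_pmull.
Qed.

(* In each box the condition [n <= X] holds everywhere or nowhere, except in
   the single box whose leading digits are those of [X]. *)
Lemma pstar_equidistribution (g X d s j r : nat) : 1 < g -> 0 < X -> 0 < d ->
  coprime d (g ^ 3 - g) -> j * s.+2 < r -> r <= half_len g X ->
  d * 2 ^ s <= 3 ^ s ->
  let K := window_den g in let H := half_len g X in
  within (K ^ j * (d * pstar_mult g X d)) (K ^ j * pstar_mult g X 1)
    (d * ((g ^ 3 - g) * K.-1 ^ j * g ^ H.+2 + K ^ j * (H.+1 * g ^ r + g ^ r.+1))).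
Proof.
move=> g1 X0 d0 dM jr rH ds K H; set M := g ^ 3 - g in dM *.
rewrite /pstar_mult !big_pstar_seq -/H -/M.
have gr : 0 < g ^ r by rewrite expn_gt0 ltnW.
pose F k h := \sum_(g ^ h <= a < g ^ h.+1)
  (if (pal g h a <= X) && coprime (pal g h a) M then nat_of_bool (k %| pal g h a) else 0).
(* For [h < r] a box of [r] digits does not fit and the count is bounded trivially. Otherwise the
   first term collects the character sum errors of all boxes, and the second is the trivial bound
   for the one box cut by [X]. *)
pose err h := if h < r then K ^ j * (d * g ^ h.+1) else
  d * M * K.-1 ^ j * g ^ h.+1 + K ^ j * (d * g ^ r).
have main h : 0 <= h < H.+1 -> within (K ^ j * (d * F d h)) (K ^ j * F 1 h) (err h).
  move=> _; rewrite /err; case: ltnP => hr.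
    have Fle k : F k h <= g ^ h.+1.
      apply: (@leq_trans (\sum_(g ^ h <= a < g ^ h.+1) 1)).
        by apply: leq_sum => a _; case: ifP => // _; exact: leq_b1.
      by rewrite sum_nat_const_nat muln1 leq_subr.
    exact: within_triv.
  rewrite /F !(sum_pal_boxes (fun n => if (n <= X) && coprime n M
                                 then nat_of_bool (_ %| n) else 0) g1 hr).
  rewrite !big_distrr /=.
  under eq_bigr => b _ do rewrite big_distrr /=.
  pose errb b := d * M * (g ^ r * K.-1 ^ j) +
     (b == X %/ g ^ (h + r)) * (K ^ j * (d * g ^ r)).
  apply: (@within_le _ _ (\sum_(g ^ (h - r) <= b < g ^ (h - r).+1) errb b)).
    rewrite big_split /= sum_nat_const_nat -big_distrl /=; apply: leq_add.
      apply: (@leq_trans (g ^ (h - r).+1 * (d * M * (g ^ r * K.-1 ^ j)))).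
        by rewrite leq_mul2r leq_subr orbT.
      rewrite -{2}(subnK hr) -addSn expnD; apply: eq_leq; ring.
    rewrite -[leqRHS]mul1n leq_mul2r; apply/orP; right.
    apply: (@leq_trans (\sum_(0 <= b < g ^ (h - r).+1) (b == X %/ g ^ (h + r)))).
      by rewrite [leqRHS](big_cat_nat _ (n := g ^ (h - r))) ?leq_addl // leq_exp2l.
    by apply: sum_nat_le1 => e e' /andP[ee _] /eqP e1 /eqP e2; lia.
  apply: within_sum => b /andP[hb bh]; rewrite /errb.
  have gG : 0 < g ^ (h + r) by rewrite expn_gt0 ltnW.
  have Gle k : \sum_(0 <= e < g ^ r)
      (if (block g h 0 r e + block g h r (h.+1 - r) b <= X) &&
          coprime (block g h 0 r e + block g h r (h.+1 - r) b) M
       then nat_of_bool (k %| block g h 0 r e + block g h r (h.+1 - r) b) else 0)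
      <= g ^ r.
    apply: (@leq_trans (\sum_(0 <= e < g ^ r) 1)).
      by apply: leq_sum => a _; case: ifP => // _; exact: leq_b1.
    by rewrite sum_nat_const_nat muln1 subn0.
  have fb e : e < g ^ r -> b * g ^ (h + r) <=
      block g h 0 r e + block g h r (h.+1 - r) b < b.+1 * g ^ (h + r).
    move=> er; rewrite -pal_split //.
    have ah : b * g ^ r + e < g ^ h.+1.
      rewrite (_ : h.+1 = (h - r).+1 + r); last by rewrite addSn subnK.
      rewrite expnD; apply: (@leq_trans (b.+1 * g ^ r)).
        by rewrite mulSn addnC ltn_add2r.
      by rewrite leq_mul2r bh orbT.
    have /andP[p1 p2] := pal_bounds g1 ah; rewrite expnD (mulnC (g ^ h)) !mulnA.
    apply/andP; split.
      by apply: leq_trans p1; rewrite leq_mul2r leq_addr orbT.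
    apply: leq_trans p2 _; rewrite leq_mul2r; apply/orP; right.
    by rewrite mulSn addnC ltn_add2r.
  have [bX|nb] := eqVneq b (X %/ g ^ (h + r)).
    rewrite mul1n; apply: within_le (leq_addl _ _) _.
    by rewrite -!big_distrr; apply: within_triv.
  rewrite mul0n addn0 -!big_distrr /=.
  have [bX|bX|/eqP] := ltngtP b (X %/ g ^ (h + r)); last by rewrite (negPf nb).
    have rh : j * s.+2 < r <= h.+1 by rewrite jr leqW.
    have := box_equidistribution (block g h r (h.+1 - r) b) g1 d0 dM rh ds.
    rewrite /= -/K -/M => bE.
    have E k : \sum_(0 <= e < g ^ r)
      (if (block g h 0 r e + block g h r (h.+1 - r) b <= X) &&
          coprime (block g h 0 r e + block g h r (h.+1 - r) b) M
       then nat_of_bool (k %| block g h 0 r e + block g h r (h.+1 - r) b) else 0) =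
      \sum_(0 <= e < g ^ r)
        ((k %| block g h 0 r e + block g h r (h.+1 - r) b) &&
          coprime (block g h 0 r e + block g h r (h.+1 - r) b) M).
      rewrite big_nat [RHS]big_nat; apply: eq_bigr => e /andP[_ er].
      have /andP[_ p2] := fb e er.
      rewrite (_ : _ <= X); first by case: coprime; rewrite ?andbT ?andbF.
      apply: leq_trans (ltnW p2) _; apply: leq_trans (leq_trunc_div X (g ^ (h + r))).
      by rewrite leq_mul2r bX orbT.
    rewrite !E; under [X in within _ (_ * X)]eq_bigr => e _ do rewrite dvd1n andTb.
    exact: bE.
  have E0 k : \sum_(0 <= e < g ^ r)
      (if (block g h 0 r e + block g h r (h.+1 - r) b <= X) &&
          coprime (block g h 0 r e + block g h r (h.+1 - r) b) M
       then nat_of_bool (k %| block g h 0 r e + block g h r (h.+1 - r) b) else 0) = 0.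
    rewrite big_nat big1 // => e /andP[_ er]; have /andP[p1 _] := fb e er.
    rewrite (_ : (_ <= X) = false) //; apply/negbTE; rewrite -ltnNge.
    apply: leq_trans p1; apply: leq_trans (ltn_ceil X gG) _.
    by rewrite leq_mul2r bX orbT.
  by rewrite !E0 !muln0; split; rewrite leq0n.
have := within_sum main; rewrite -!big_distrr /=; apply: within_le.
rewrite (big_cat_nat _ (n := r)) //=; last exact: leqW.
have -> : d * (M * K.-1 ^ j * g ^ H.+2 + K ^ j * (H.+1 * g ^ r + g ^ r.+1)) =
   K ^ j * (d * g ^ r.+1) +
   (d * M * K.-1 ^ j * g ^ H.+2 + H.+1 * (K ^ j * (d * g ^ r))) by ring.
apply: leq_add.
  rewrite big_nat (eq_bigr (fun h => K ^ j * d * g ^ h.+1)); last first.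
    by move=> h /andP[_ hr]; rewrite /err hr mulnA.
  by rewrite -big_nat -big_distrr /= mulnA leq_mul2l sum_succ_pow_le ?orbT.
rewrite big_nat (eq_bigr (fun h => d * M * K.-1 ^ j * g ^ h.+1 + K ^ j * (d * g ^ r))); last first.
  by move=> h /andP[hr _]; rewrite /err ltnNge hr.
rewrite -big_nat big_split /= sum_nat_const_nat -big_distrr /=; apply: leq_add.
  rewrite leq_mul2l; apply/orP; right; apply: leq_trans (sum_succ_pow_le H.+1 g1).
  by rewrite [leqRHS](big_cat_nat _ (n := r)) ?leq_addl //; apply: leqW.
by rewrite leq_mul2r leq_subr orbT.
Qed.

End Equidistribution.

(** * Inverse squares, sieving by primes, and the Moebius series *)

Section InverseSquares.
Variable R : realFieldType.
Implicit Types (F : nat -> R).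

Definition invsq (k : nat) : R := (k%:R ^+ 2)^-1.

Lemma invsq_ge0 (k : nat) : 0 <= invsq k.
Proof. by rewrite /invsq invr_ge0 exprn_ge0. Qed.

Lemma invsqM (m n : nat) : invsq (m * n) = invsq m * invsq n.
Proof. by rewrite /invsq natrM exprMn invfM. Qed.

Lemma sum_invsq_tail (m n : nat) : (0 < m)%N ->
  \sum_(m <= k < n) invsq k <= 2 / m%:R.
Proof.
move=> m0; have [nm|mn] := leqP n m; first by rewrite big_geq // divr_ge0.
have n0 : (0 < n)%N by apply: leq_trans m0 (ltnW mn).
(* Telescoping: [1 / k ^ 2 <= 2 / k - 2 / (k + 1)] for [k >= 1]. *)
suff : \sum_(m <= k < n) invsq k <= 2 / m%:R - 2 / n%:R.
  by move=> /le_trans; apply; rewrite lerBlDr lerDl divr_ge0.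
elim: n mn n0 => // n IH mn _.
rewrite big_nat_recr //=.
have [->|nm] := eqVneq n m; last first.
  have mn' : (m < n)%N by rewrite ltn_neqAle eq_sym nm -ltnS.
  have n0 : (0 < n)%N by apply: ltn_trans mn'.
  apply: le_trans (lerD (IH mn' n0) (lexx _)) _.
  have x0 : (0 : R) < n%:R by rewrite ltr0n.
  have x1 : (1 : R) <= n%:R by rewrite (ler_nat _ 1).
  rewrite -addrA lerD2l /invsq -[n.+1%:R]natr1; move: (n%:R : R) x0 x1 => x x0 x1.
  rewrite -subr_ge0 (_ : _ - _ = (x - 1) / (x ^+ 2 * (x + 1))); last by field; lra.
  by rewrite divr_ge0 ?mulr_ge0 ?exprn_ge0 //; lra.
have x0 : (0 : R) < m%:R by rewrite ltr0n.
have x1 : (1 : R) <= m%:R by rewrite (ler_nat _ 1).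
rewrite big_geq // add0r /invsq -[m.+1%:R]natr1; move: (m%:R : R) x0 x1 => x x0 x1.
rewrite -subr_ge0 (_ : _ - _ = (x - 1) / (x ^+ 2 * (x + 1))); last by field; lra.
by rewrite divr_ge0 ?mulr_ge0 ?exprn_ge0 //; lra.
Qed.

Lemma sum_multiples (D d : nat) F : (0 < d)%N ->
  \sum_(1 <= n < D | (d %| n)%N) F n = \sum_(1 <= k < D | (d * k < D)%N) F (d * k)%N.
Proof.
move=> d0; rewrite -big_filter -[RHS]big_filter.
rewrite -(big_map (fun k => d * k)%N xpredT F); apply: perm_big; apply: uniq_perm.
- by rewrite filter_uniq ?iota_uniq.
- rewrite map_inj_uniq ?filter_uniq ?iota_uniq // => a b /eqP.
  by rewrite eqn_pmul2l // => /eqP.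
move=> n; rewrite mem_filter mem_index_iota; apply/andP/mapP.
  move=> [/dvdnP[k ->] /andP[k0 kD]]; exists k; last by rewrite mulnC.
  rewrite mem_filter mem_index_iota mulnC kD.
  have -> : (0 < k)%N by move: k0; rewrite muln_gt0 => /andP[].
  by apply: leq_ltn_trans kD; rewrite leq_pmulr.
move=> [k + ->]; rewrite mem_filter mem_index_iota => /and3P[-> k0 _].
by rewrite dvdn_mulr // muln_gt0 d0 k0.
Qed.

Lemma sum_le_invsq (P : pred nat) (D : nat) : (0 < D)%N ->
  \sum_(1 <= k < D | P k) invsq k <= 2.
Proof.
move=> D0; apply: (@le_trans _ _ (\sum_(1 <= k < D) invsq k)).
  rewrite big_mkcond /=; apply: ler_sum => k _; case: ifP => // _.
  exact: invsq_ge0.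
by apply: le_trans (@sum_invsq_tail 1 D isT) _; rewrite divr1.
Qed.

Definition free_of (ps : seq nat) (k : nat) : bool := all (fun p => ~~ (p %| k)%N) ps.

Lemma free_of_primes (M k : nat) : (0 < M)%N -> free_of (primes M) k = coprime k M.
Proof.
move=> M0; apply/allP/idP => [H|kM p].
  rewrite /coprime; have [g1|] := leqP (gcdn k M) 1.
    by rewrite eqn_leq g1 gcdn_gt0 M0 orbT.
  move=> g1; have pp := pdiv_prime g1.
  have pg := pdiv_dvd (gcdn k M).
  have := H (pdiv (gcdn k M)); rewrite mem_primes pp M0 (dvdn_trans pg (dvdn_gcdr _ _)).
  by rewrite (dvdn_trans pg (dvdn_gcdl _ _)) => /(_ isT).
rewrite mem_primes => /and3P[pp _ pM]; apply/negP => pk.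
have : (p %| gcdn k M)%N by rewrite dvdn_gcd pk.
by rewrite (eqP kM) dvdn1 => /eqP p1; rewrite p1 in pp.
Qed.

(* Removing the multiples of one prime at a time multiplies the limit by
   [1 - p^-2]. *)
Lemma sum_free_of_limit (z : R) (ps : seq nat) : uniq ps -> all prime ps ->
  (forall D, (0 < D)%N -> `|\sum_(1 <= k < D) invsq k - z| <= 2 / D%:R) ->
  exists2 C, 0 <= C & forall D, (0 < D)%N ->
    `|\sum_(1 <= k < D | free_of ps k) invsq k - z * \prod_(p <- ps) (1 - invsq p)|
      <= C / D%:R.
Proof.
move=> + + Hz; elim: ps => [|p ps IH] /=.
  by move=> _ _; exists 2 => // D D0; rewrite big_nil mulr1; exact: Hz.
move=> /andP[pps ups] /andP[pp pps']; have [C C0 HC] := IH ups pps'.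
have p0 := prime_gt0 pp.
exists (C + C) => [|D D0]; first by rewrite addr_ge0.
(* [D / p] rounded up, so that the multiples [p * k] below [D] are exactly those with [k < D']. *)
pose D' := ((D + p.-1) %/ p)%N.
have kD' k : (p * k < D)%N = (k < D')%N.
  by rewrite /D' leq_divRL // mulSn mulnC; lia.
have D'0 : (0 < D')%N by rewrite -kD' muln0.
have D'D : (D' <= D)%N by rewrite leqNgt -kD' -leqNgt leq_pmull.
have pD' : (D <= p * D')%N by rewrite leqNgt kD' ltnn.
have E : \sum_(1 <= k < D | free_of (p :: ps) k) invsq k =
    \sum_(1 <= k < D | free_of ps k) invsq k -
    invsq p * \sum_(1 <= k < D' | free_of ps k) invsq k.
  rewrite [X in _ = X - _](bigID (fun k => (p %| k)%N)) /=.
  rewrite addrC; apply/eqP; rewrite -subr_eq opprK addrC; apply/eqP.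
  rewrite [RHS]addrC; congr (_ + _); first by apply: eq_bigl => k; rewrite andbC.
  symmetry; rewrite (eq_bigl (fun k => (p %| k)%N && free_of ps k)); last first.
    by move=> k; rewrite andbC.
  rewrite big_mkcondr /= (sum_multiples D (fun k => if free_of ps k then invsq k else 0) p0).
  rewrite [LHS](eq_bigl (fun k => (k < D')%N)); last by move=> k; rewrite kD'.
  rewrite -(big_nat_widen _ _ _ xpredT) // -big_mkcond /= mulr_sumr.
  rewrite big_nat_cond [RHS]big_nat_cond; apply: eq_big => [k|k _]; last by rewrite invsqM.
  case: (1 <= k < D')%N => //=; apply: eq_in_all => q qps.
  rewrite Euclid_dvdM ?(allP pps' q qps) //.
  rewrite dvdn_prime2 ?(allP pps' q qps) //.
  by case: eqVneq => // qp; rewrite -qp qps in pps.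
rewrite E big_cons.
set A := \sum_(_ <= _ < D | _) _; set B := \sum_(_ <= _ < D' | _) _.
set L := \prod_(_ <- ps) _.
have -> : A - invsq p * B - z * ((1 - invsq p) * L) =
   (A - z * L) - invsq p * (B - z * L) by ring.
apply: le_trans (ler_normB _ _) _; rewrite mulrDl; apply: lerD; first exact: HC.
rewrite normrM (ger0_norm (invsq_ge0 p)).
apply: le_trans (ler_wpM2l (invsq_ge0 p) (HC D' D'0)) _.
rewrite mulrCA ler_wpM2l // /invsq.
have px : 0 < p%:R :> R by rewrite ltr0n.
have dx : 0 < D%:R :> R by rewrite ltr0n.
have d'x : 0 < D'%:R :> R by rewrite ltr0n.
have p1 : 1 <= p%:R :> R by rewrite (ler_nat _ 1).
have pdd : D%:R <= p%:R * D'%:R :> R by rewrite -natrM ler_nat.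
rewrite -invfM lef_pV2 ?posrE ?mulr_gt0 ?exprn_gt0 //.
have pD0 : 0 <= p%:R * D'%:R :> R by rewrite mulr_ge0 // ltW.
by apply: le_trans pdd _; rewrite expr2 -mulrA ler_peMl.
Qed.

Definition moebius_sum (M D : nat) : R :=
  \sum_(1 <= d < D | coprime d M) (moebius d)%:~R * invsq d.

Lemma norm_moebiusR (d : nat) : `|(moebius d)%:~R| <= 1 :> R.
Proof. by rewrite -intr_norm (ler_int _ _ 1) norm_moebius. Qed.

Lemma norm_moebius_sum (M D : nat) : (0 < D)%N -> `|moebius_sum M D| <= 2.
Proof.
move=> D0; apply: le_trans (ler_norm_sum _ _ _) _.
apply: le_trans (sum_le_invsq (fun d => coprime d M) D0); apply: ler_sum => d _.
rewrite normrM (ger0_norm (invsq_ge0 d)) ler_piMl ?invsq_ge0 //.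
exact: norm_moebiusR.
Qed.

Lemma sum_moebius_dvd (D n : nat) : (0 < n < D)%N ->
  \sum_(1 <= d < D | (d %| n)%N) (moebius d)%:~R = (n == 1)%:R :> R.
Proof.
move=> /andP[n0 nD].
have -> : (n == 1)%:R = ((n == 1)%:R : int)%:~R :> R by case: (n == 1).
rewrite -(sum_moebius_divisors n0) rmorph_sum /= -big_filter.
apply: perm_big; apply: uniq_perm; rewrite ?filter_uniq ?iota_uniq ?divisors_uniq //.
move=> d; rewrite mem_filter mem_index_iota -dvdn_divisors //.
case: (boolP (d %| n)%N) => //= dn.
by rewrite (dvdn_gt0 n0 dn) (leq_ltn_trans (dvdn_leq n0 dn) nD).
Qed.

(* In the product of the two partial sums, the terms with [d k < y^2] add up
   to 1 by Moebius inversion, and in the others [d >= y] or [k >= y]. *)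
Lemma moebius_sum_inverse (M y : nat) : (0 < y)%N ->
  `|moebius_sum M (y ^ 2) * (\sum_(1 <= k < y ^ 2 | coprime k M) invsq k) - 1|
    <= 8 / y%:R.
Proof.
move=> y0; set D := (y ^ 2)%N; have D0 : (0 < D)%N by rewrite expn_gt0 y0.
have [y1|y1] := leqP y 1.
  have y1' : y = 1%N by lia.
  rewrite /moebius_sum /D y1' exp1n !big_geq // mul0r sub0r normrN normr1 divr1.
  by rewrite (ler_nat _ 1 8).
have D1 : (1 < D)%N by rewrite -(exp1n 2) ltn_exp2r.
pose G d n : R := (coprime n M)%:R * (moebius d)%:~R * invsq n.
have prodE : moebius_sum M D * (\sum_(1 <= k < D | coprime k M) invsq k) =
    \sum_(1 <= d < D) \sum_(1 <= k < D) G d (d * k)%N.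
  rewrite /moebius_sum [X in X * _]big_mkcond [X in _ * X]big_mkcond /= mulr_suml.
  apply: eq_bigr => d _; rewrite mulr_sumr; apply: eq_bigr => k _.
  rewrite /G coprimeMl invsqM.
  by case: coprime; case: coprime; rewrite /= ?mul0r ?mulr0 ?mul1r // mulrA.
have low : \sum_(1 <= d < D) \sum_(1 <= k < D | (d * k < D)%N) G d (d * k)%N = 1.
  rewrite big_nat (eq_bigr (fun d => \sum_(1 <= n < D | (d %| n)%N) G d n)); last first.
    by move=> d /andP[d0 _]; rewrite sum_multiples.
  rewrite -big_nat (eq_bigr (fun d => \sum_(1 <= n < D) (if (d %| n)%N then G d n else 0))); last first.
    by move=> d _; rewrite big_mkcond.
  rewrite exchange_big /= big_ltn // [X in _ + X]big_nat [X in _ + X]big1 => [|n /andP[n1 nD]].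
    rewrite addr0 -big_mkcond /= /G.
    rewrite -(mulr_suml) -mulr_sumr sum_moebius_dvd // coprime1n /invsq expr1n invr1.
    by rewrite !mulr1.
  rewrite -big_mkcond /= /G -mulr_suml -mulr_sumr sum_moebius_dvd ?nD ?(ltnW n1) //.
  by rewrite gtn_eqF // mulr0 mul0r.
have split2 : \sum_(1 <= d < D) \sum_(1 <= k < D) G d (d * k)%N - 1 =
    \sum_(1 <= d < D) \sum_(1 <= k < D | ~~ (d * k < D)%N) G d (d * k)%N.
  rewrite -low -sumrB; apply: eq_bigr => d _.
  by rewrite (bigID (fun k => (d * k < D)%N)) /= addrC addrK.
rewrite prodE split2.
have Gle d n : `|G d n| <= invsq n.
  rewrite /G normrM (ger0_norm (invsq_ge0 n)) ler_piMl ?invsq_ge0 // normrM.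
  by rewrite mulr_ile1 ?normr_ge0 ?norm_moebiusR // normr_nat lern1 leq_b1.
apply: (@le_trans _ _ (\sum_(1 <= d < D) \sum_(1 <= k < D)
   ((y <= d)%:R * invsq d * invsq k + (y <= k)%:R * invsq k * invsq d))).
  apply: le_trans (ler_norm_sum _ _ _) _; rewrite big_nat [leRHS]big_nat.
  apply: ler_sum => d /andP[d0 dD]; apply: le_trans (ler_norm_sum _ _ _) _.
  rewrite big_mkcond /= big_nat [leRHS]big_nat; apply: ler_sum => k /andP[k0 kD].
  have pos : 0 <= (y <= d)%:R * invsq d * invsq k + (y <= k)%:R * invsq k * invsq d.
    by rewrite addr_ge0 // !mulr_ge0 ?invsq_ge0.
  case: ifPn => // dk; apply: le_trans (Gle _ _) _; rewrite invsqM.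
  have [yd|yd] := leqP y d; first by rewrite mul1r lerDl !mulr_ge0 ?invsq_ge0.
  have [yk|yk] := leqP y k; first by rewrite mul1r mulrC lerDr !mulr_ge0 ?invsq_ge0.
  by case/negP: dk; rewrite /D -mulnn ltn_mul.
have Y0 : 0 < y%:R :> R by rewrite ltr0n.
set a := \sum_(1 <= d < D) (y <= d)%:R * invsq d; set b := \sum_(1 <= k < D) invsq k.
have a2 : 0 <= a <= 2 / y%:R.
  rewrite /a sumr_ge0 => [|d _]; last by rewrite mulr_ge0 ?invsq_ge0.
  apply: le_trans (sum_invsq_tail D y0).
  rewrite (big_cat_nat _ (n := y)) //=; last by rewrite /D -mulnn leq_pmulr.
  rewrite big_nat big1 ?add0r => [|d /andP[_ dy]]; last by rewrite leqNgt dy mul0r.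
  by rewrite big_nat [leRHS]big_nat; apply: ler_sum => d /andP[-> _]; rewrite mul1r.
have b2 : 0 <= b <= 2.
  rewrite /b sumr_ge0 => [|d _]; last exact: invsq_ge0.
  exact: (sum_le_invsq xpredT D0).
have -> : \sum_(1 <= d < D) \sum_(1 <= k < D)
   ((y <= d)%:R * invsq d * invsq k + (y <= k)%:R * invsq k * invsq d) =
   a * b + a * b.
  under eq_bigr => d _ do rewrite big_split /= -mulr_sumr -mulr_suml.
  by rewrite big_split /= -mulr_suml -mulr_sumr -/a -/b.
have : a * b <= 2 / y%:R * 2 by apply: ler_pM; case/andP: a2; case/andP: b2.
move=> ab; apply: le_trans (lerD ab ab) _.
by rewrite le_eqVlt; apply/orP; left; apply/eqP; field; lra.
Qed.

(** With [L = z * P], [MU - 1 / L = ((MU * Z - 1) - MU * (Z - L)) / L]: as [|MU| <= 2], both the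
    defect of the product and the error of [Z] pass to [MU]. *)
Lemma moebius_sum_limit (z : R) (M : nat) : (0 < M)%N -> 0 < z ->
  (forall D, (0 < D)%N -> `|\sum_(1 <= k < D) invsq k - z| <= 2 / D%:R) ->
  exists2 C, 0 <= C & forall y, (0 < y)%N ->
    `|moebius_sum M (y ^ 2) - z^-1 * \prod_(p <- primes M) (1 - invsq p)^-1| <= C / y%:R.
Proof.
move=> M0 z0 Hz.
have [C C0 HC] := sum_free_of_limit (primes_uniq M) (all_prime_primes M) Hz.
set P := \prod_(p <- primes M) (1 - invsq p) in HC.
have P0 : 0 < P.
  rewrite /P big_seq; apply: prodr_gt0 => p; rewrite mem_primes => /and3P[pp _ _].
  have p1 : 1 < p%:R :> R by rewrite (ltr_nat _ 1) prime_gt1.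
  by rewrite subr_gt0 /invsq invf_lt1 ?exprn_gt0 ?exprn_egt1 //; lra.
have L0 : 0 < z * P by rewrite mulr_gt0.
have -> : z^-1 * \prod_(p <- primes M) (1 - invsq p)^-1 = (z * P)^-1.
  by rewrite invfM /P prodfV.
exists ((8 + 2 * C) / (z * P)) => [|y y0].
  by rewrite divr_ge0 ?(ltW L0) // addr_ge0 // mulr_ge0.
have D0 : (0 < y ^ 2)%N by rewrite expn_gt0 y0.
have h1 := moebius_sum_inverse M y0.
have h2 := HC _ D0; rewrite (eq_bigl (fun k => coprime k M)) in h2; last first.
  by move=> k; rewrite free_of_primes.
have h3 := norm_moebius_sum M D0.
set MU := moebius_sum _ _ in h1 h3 *; set Z := \sum_(_ <= _ < _ | _) _ in h1 h2.
set L := z * P in L0 h2 *.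
have Y0 : 0 < y%:R :> R by rewrite ltr0n.
have h2' : `|Z - L| <= C / y%:R.
  apply: le_trans h2 _; rewrite ler_wpM2l // lef_pV2 ?posrE ?ltr0n //.
  by rewrite ler_nat -mulnn leq_pmulr.
have -> : MU - L^-1 = ((MU * Z - 1) - MU * (Z - L)) / L by field; lra.
rewrite normrM normfV (gtr0_norm L0) mulrAC ler_pM2r ?invr_gt0 //.
apply: le_trans (ler_normB _ _) _; rewrite mulrDl; apply: lerD => //.
by rewrite normrM -mulrA ler_pM.
Qed.

End InverseSquares.

(** * Choice of parameters *)

Section Assembly.
Local Open Scope nat_scope.

(** The eight scales [k = 8 v, ..., 8 v + 7] share the value [k %/ 8 = v]. *)
Lemma octave_sq_mean (g : nat) : 1 < g ->
  exists2 C, 0 < C & forall X v, 0 < X ->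
    g ^ v * (\sum_(g ^ (8 * v) <= d < g ^ (8 * v.+1)) pstar_mult g X d ^ 2) <=
    C * g ^ (2 * half_len g X).
Proof.
move=> g1; have [C C0 HC] := pstar_mult_sq_mean g1.
exists (8 * C) => [|X v X0]; first by rewrite muln_gt0.
pose f k := \sum_(g ^ k <= d < g ^ k.+1) pstar_mult g X d ^ 2.
have split8 n : \sum_(g ^ (8 * v) <= d < g ^ (8 * v + n)) pstar_mult g X d ^ 2 =
    \sum_(0 <= i < n) f (8 * v + i).
  elim: n => [|n IH]; first by rewrite addn0 !big_geq.
  rewrite big_nat_recr //= -IH addnS.
  by rewrite (big_cat_nat _ (n := g ^ (8 * v + n))) // leq_exp2l //; lia.
rewrite mulnS addnC split8 big_distrr /= -mulnA.
apply: (@leq_trans (\sum_(0 <= i < 8) C * g ^ (2 * half_len g X))); last first.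
  by rewrite sum_nat_const_nat.
rewrite big_nat [leqRHS]big_nat; apply: leq_sum => i /andP[_ i8].
have E : (8 * v + i) %/ 8 = v by lia.
by have := HC X (8 * v + i) X0; rewrite E.
Qed.

Lemma Bernoulli_expn (a n : nat) : a ^ n.+1 + n.+1 * a ^ n <= a.+1 ^ n.+1.
Proof.
elim: n => [|n IH]; first by rewrite !expn1 expn0; lia.
rewrite [leqRHS]expnS; apply: leq_trans (leq_mul (leqnn _) IH).
by rewrite !(expnS a); move: (a ^ n) => x; nia.
Qed.

(** Each window saves [(K - 1) / K], so [K] windows save a factor 2. *)
Lemma two_mul_pred_expn (K : nat) : 0 < K -> 2 * K.-1 ^ K <= K ^ K.
Proof.
case: K => // K _ /=; apply: leq_trans (Bernoulli_expn K K).
by rewrite mul2n -addnn leq_add2l expnS leq_mul2r leqnSn orbT.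
Qed.

Lemma square_bracket (B H : nat) : 0 < B -> exists u, B * u ^ 2 <= H < B * u.+1 ^ 2.
Proof.
move=> B0; have ex : exists u, B * u ^ 2 <= H by exists 0; rewrite muln0.
have ub u : B * u ^ 2 <= H -> u <= H.
  by move=> Bu; apply: leq_trans Bu; rewrite -mulnn mulnA; nia.
case: (ex_maxnP ex ub) => u Hu max; exists u; rewrite Hu ltnNge.
by apply/negP => /max; rewrite ltnn.
Qed.

(* For [d < g^(8u)], windows of length about [16 g u] are long enough, and about
   [9 g K u] disjoint ones fit among the inner third of the digits as soon as
   [H] exceeds a constant times [u^2]. *)
Lemma pstar_equidistribution_range (g : nat) : 1 < g ->
  exists c B, 0 < B /\ forall X, 0 < X -> exists u,
    half_len g X < B * u.+1 ^ 2 /\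
    forall d, 0 < d < g ^ (8 * u) -> coprime d (g ^ 3 - g) ->
      within (g ^ (9 * u) * (d * pstar_mult g X d)) (g ^ (9 * u) * pstar_mult g X 1)
        (d * c * g ^ half_len g X).
Proof.
move=> g1; have g0 : 0 < g by apply: ltnW.
set M := g ^ 3 - g; set K := window_den g.
have K0 : 0 < K by apply: window_den_gt0.
(* [486 = 3 * 162]: below, [j * s.+2 <= 162 * g ^ 2 * K * u ^ 2], and only [r = H %/ 3] digits are
   available. The summand 3 yields the strict inequality. *)
pose B := 486 * g ^ 2 * K + 3.
exists (M * g ^ 2 + 3 + g), B; split=> [|X X0]; first by rewrite /B addn_gt0 orbT.
set H := half_len g X.
have B0 : 0 < B by rewrite /B addn_gt0 orbT.
have [u /andP[uH Hu]] := square_bracket H B0; exists u; split=> // d /andP[d0 du] dM.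
have u0 : 0 < u by move: du d0; case: (u) => //; rewrite muln0 expn0; lia.
(* From [d < 2 ^ (8 * g * u)] and [8 < 9] follows [d * 2 ^ s <= 3 ^ s]. The saving sought is
   [g ^ (9 * u)]: [g ^ (8 * u)] for the later sum over [d] and [g ^ u] for the final error. It is at
   most [2 ^ (9 * g * u)], that is [9 * g * u] groups of [K] windows. With [r] a third of [H], the
   factors [H.+1] and [g ^ (9 * u)] of the cut boxes cost at most [3 * g ^ r] and [g ^ r]. *)
pose s := 16 * g * u; pose j := 9 * g * K * u; pose r := H %/ 3.
have g2g : g <= 2 ^ g by apply: ltnW; apply: ltn_expl.
have jr : j * s.+2 < r.
  rewrite /r /j /s leq_divRL //; apply: leq_trans uH.
  have gg : 0 < g * K * u by rewrite muln_gt0 muln_gt0 g0 u0 K0.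
  have E : 9 * g * K * u * (16 * g * u).+2 <= 162 * g ^ 2 * K * u ^ 2.
    have -> : 162 * g ^ 2 * K * u ^ 2 = 9 * (g * K * u) * (18 * (g * u)) by ring.
    have -> : 9 * g * K * u * (16 * g * u).+2 = 9 * (g * K * u) * (16 * g * u).+2 by ring.
    rewrite leq_mul2l; apply/orP; right.
    have : 0 < g * u by rewrite muln_gt0 g0.
    by rewrite -mulnA; lia.
  apply: (@leq_trans ((162 * g ^ 2 * K * u ^ 2).+1 * 3)).
    by rewrite leq_mul2r ltnS E.
  rewrite /B mulnDl mulSn addnC leq_add //; first by apply: eq_leq; ring.
  by rewrite leq_pmulr // expn_gt0 u0.
have ur : 9 * u <= r.
  apply: ltnW; apply: leq_ltn_trans jr; rewrite /j.
  have : 0 < g * K by rewrite muln_gt0 g0.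
  by have -> : 9 * g * K * u * s.+2 = 9 * u * (g * K * s.+2) by [ring]; nia.
have rH : r <= H by rewrite leq_div.
have r3 : 3 * r <= H by rewrite mulnC leq_trunc_div.
have ds : d * 2 ^ s <= 3 ^ s.
  apply: (@leq_trans (2 ^ (8 * g * u) * 2 ^ s)).
    rewrite leq_mul2r; apply/orP; right; apply: leq_trans (ltnW du) _.
    rewrite (_ : 8 * g * u = g * (8 * u)); last by ring.
    by rewrite (expnM 2) leq_exp2r // muln_gt0.
  rewrite /s -expnD (_ : 8 * g * u + 16 * g * u = 3 * (8 * g * u)); last by ring.
  rewrite (_ : 16 * g * u = 2 * (8 * g * u)); last by ring.
  by rewrite (expnM 2 3) (expnM 3 2) leq_exp2r // !muln_gt0 g0.
have Kj : g ^ (9 * u) * K.-1 ^ j <= K ^ j.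
  apply: (@leq_trans (2 ^ (9 * g * u) * K.-1 ^ j)).
    rewrite leq_mul2r; apply/orP; right.
    rewrite (_ : 9 * g * u = g * (9 * u)); last by ring.
    by rewrite (expnM 2) leq_exp2r // muln_gt0.
  rewrite /j (_ : 9 * g * K * u = K * (9 * g * u)); last by ring.
  by rewrite (expnM K.-1 K) (expnM K K) -expnMn leq_exp2r ?two_mul_pred_expn // !muln_gt0 g0.
have Kj0 : 0 < K ^ j by rewrite expn_gt0 K0.
have r1 : H.+1 * g ^ r * g ^ (9 * u) <= 3 * g ^ H.
  apply: (@leq_trans (3 * g ^ r * g ^ r * g ^ r)).
    apply: leq_mul; last by rewrite leq_exp2l.
    rewrite leq_mul2r; apply/orP; right.
    have : r < g ^ r by apply: ltn_expl.
    by have := ltn_ceil H (isT : 0 < 3); rewrite -/r; lia.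
  by rewrite -!mulnA leq_mul2l -!expnD leq_exp2l //; lia.
have r2 : g ^ r.+1 * g ^ (9 * u) <= g * g ^ H.
  by rewrite -expnD -expnS leq_exp2l //; lia.
have [] := pstar_equidistribution g1 X0 d0 dM jr rH ds.
rewrite -/K -/M -/H; set A := pstar_mult g X d; set N := pstar_mult g X 1.
set e := d * (M * _ * _ + _) => h1 h2.
have eb : g ^ (9 * u) * e <= K ^ j * (d * (M * g ^ 2 + 3 + g) * g ^ H).
  have -> : g ^ (9 * u) * e = d * (M * g ^ 2 * g ^ H * (g ^ (9 * u) * K.-1 ^ j) +
     K ^ j * (H.+1 * g ^ r * g ^ (9 * u) + g ^ r.+1 * g ^ (9 * u))).
    by rewrite /e (_ : H.+2 = 2 + H) // expnD; ring.
  have -> : K ^ j * (d * (M * g ^ 2 + 3 + g) * g ^ H) =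
    d * (M * g ^ 2 * g ^ H * K ^ j + K ^ j * (3 * g ^ H + g * g ^ H)) by ring.
  rewrite leq_mul2l; apply/orP; right; apply: leq_add.
    by rewrite leq_mul2l Kj orbT.
  by rewrite leq_mul2l leq_add ?orbT.
have mul x y : x <= y -> g ^ (9 * u) * x <= g ^ (9 * u) * y.
  by move=> xy; rewrite leq_mul2l xy orbT.
split; rewrite -(leq_pmul2l Kj0) mulnDr; apply: leq_trans (leq_add (leqnn _) eb).
  by rewrite mulnCA [K ^ j * (_ * N)]mulnCA -mulnDr; apply: mul.
by rewrite mulnCA [K ^ j * (_ * (d * A))]mulnCA -mulnDr; apply: mul.
Qed.

Definition coprime_count (g X : nat) : nat :=
  \sum_(m <- pstar_seq g X) \sum_(n <- pstar_seq g X) coprime m n.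

Lemma pstar_mult_le1 (g X d : nat) : pstar_mult g X d <= pstar_mult g X 1.
Proof. by apply: leq_sum => n _; rewrite dvd1n leq_b1. Qed.

End Assembly.

(** * The asymptotic formula for the number of coprime pairs *)

Section Asymptotics.
Variable R : realFieldType.

Lemma coprime_count_moebius (g X D : nat) : (1 < g)%N -> (X < D)%N ->
  (coprime_count g X)%:R =
  \sum_(1 <= d < D) (moebius d)%:~R * (pstar_mult g X d)%:R ^+ 2 :> R.
Proof.
move=> g1 XD; rewrite /coprime_count natr_sum.
transitivity (\sum_(m <- pstar_seq g X) \sum_(n <- pstar_seq g X)
   \sum_(1 <= d < D) (moebius d)%:~R * ((d %| m)%N%:R * (d %| n)%N%:R) : R).
  rewrite big_seq [RHS]big_seq; apply: eq_bigr => m /(mem_pstar_seq g1)/andP[m0 mX].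
  rewrite natr_sum big_seq [RHS]big_seq; apply: eq_bigr => n _.
  have gb : (0 < gcdn m n < D)%N.
    rewrite gcdn_gt0 m0 /=; apply: leq_ltn_trans XD.
    by apply: leq_trans mX; rewrite dvdn_leq ?dvdn_gcdl.
  rewrite /coprime -(sum_moebius_dvd R gb) big_mkcond /=; apply: eq_bigr => d _.
  rewrite dvdn_gcd; case: (d %| m)%N; case: (d %| n)%N;
  by rewrite /= ?mulr1 ?mulr0 ?mul0r ?mulr0.
under eq_bigr => m _ do rewrite exchange_big /=.
rewrite exchange_big /=; apply: eq_bigr => d _.
rewrite /pstar_mult natr_sum expr2 mulr_suml mulr_sumr; apply: eq_bigr => m _.
by rewrite -mulr_sumr -mulr_sumr.
Qed.

(** With [q = 1 / g <= 1 / 2] one has [q ^ v <= 2 * (q ^ v - q ^ (v + 1))], so the bounds for the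
    ranges from [g^(8v)] to [g^(8v+8)] telescope, uniformly in [w]. *)
Lemma pstar_sq_tail (g : nat) : (1 < g)%N ->
  exists2 C : R, 0 <= C & forall X u w, (0 < X)%N ->
    \sum_(g ^ (8 * u) <= d < g ^ (8 * (u + w))) (pstar_mult g X d)%:R ^+ 2 <=
    C * g%:R ^+ (2 * half_len g X) * g%:R^-1 ^+ u :> R.
Proof.
move=> g1; have [C C0 HC] := octave_sq_mean g1.
have q0 : 0 < g%:R^-1 :> R by rewrite invr_gt0 ltr0n ltnW.
have q2 : g%:R^-1 <= 2^-1 :> R by rewrite lef_pV2 ?posrE ?ltr0n ?(ltnW g1) // (ler_nat _ 2).
set q := _^-1 in q0 q2 *.
exists (2 * C%:R) => [|X u w X0]; first by rewrite mulr_ge0.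
set T := g%:R ^+ _; have T0 : 0 <= T by rewrite exprn_ge0.
have oct v : \sum_(g ^ (8 * v) <= d < g ^ (8 * v.+1)) (pstar_mult g X d)%:R ^+ 2 <=
   2 * C%:R * T * (q ^+ v - q ^+ v.+1) :> R.
  have : C%:R * T * q ^+ v <= 2 * C%:R * T * (q ^+ v - q ^+ v.+1).
    rewrite exprS -[X in X - _]mul1r -mulrBl mulrA.
    rewrite ler_pM2r ?exprn_gt0 // -[leLHS]mulr1 (mulrC 2) -!mulrA ler_wpM2l //.
    by rewrite mulrCA ler_wpM2l //; lra.
  apply: le_trans; rewrite exprVn ler_pdivlMr ?exprn_gt0 ?ltr0n ?(ltnW g1) // mulrC.
  have := HC X v X0; rewrite -(ler_nat R) !natrM !natrX natr_sum.
  by under eq_bigr => d _ do rewrite natrX.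
apply: (@le_trans _ _ (2 * C%:R * T * (q ^+ u - q ^+ (u + w)))); last first.
  by rewrite ler_wpM2l ?mulr_ge0 // gerBl exprn_ge0 // ltW.
elim: w => [|w IH]; first by rewrite addn0 big_geq // subrr mulr0.
rewrite addnS (big_cat_nat _ (n := g ^ (8 * (u + w)))) ?leq_exp2l //=; try lia.
apply: le_trans (lerD IH (oct (u + w)%N)) _.
by rewrite -mulrDr addrA subrK.
Qed.

(** The limit [kappa] of the Moebius series is kept abstract. [pstar_mult1_ge] converts the powers
    of [g ^ H] in the error terms into powers of [N = A_1], which makes the errors relative. *)
Lemma coprime_count_asymptotics (g : nat) (kappa C0 : R) : (1 < g)%N -> 0 <= C0 ->
  (forall y, (0 < y)%N -> `|moebius_sum R (g ^ 3 - g) (y ^ 2) - kappa| <= C0 / y%:R) ->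
  exists (B : nat) (C : R), (0 < B)%N /\ 0 <= C /\ forall X, (0 < X)%N ->
    exists2 u, (half_len g X < B * u.+1 ^ 2)%N &
      `|(coprime_count g X)%:R - kappa * (pstar_mult g X 1)%:R ^+ 2| <=
        C * (pstar_mult g X 1)%:R ^+ 2 * g%:R^-1 ^+ u.
Proof.
move=> g1 C00 Hk; have [c [B [B0 HB]]] := pstar_equidistribution_range g1.
have [C1 C10 HC1] := pstar_sq_tail g1.
have G0 : 0 < g%:R :> R by rewrite ltr0n ltnW.
exists B, (2 * c%:R * g%:R ^+ 4 + C0 + C1 * g%:R ^+ 8); split=> //; split.
  by rewrite !addr_ge0 ?mulr_ge0 ?exprn_ge0 // ltW.
move=> X X0; have [u [uH Hu]] := HB X X0; exists u => //.
have low := pstar_mult1_ge g1 X0.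
set H := half_len g X in uH Hu low *; set A := pstar_mult g X in low *.
set N := A 1%N in low *; set M := (g ^ 3 - g)%N in Hk Hu *.
set q := g%:R^-1 : R.
have q0 : 0 < q by rewrite invr_gt0.
have q1 : q <= 1 by rewrite invf_le1 // (ler_nat _ 1) ltnW.
have lowR : g%:R ^+ H <= g%:R ^+ 4 * N%:R :> R by rewrite -!natrX -natrM ler_nat.
have gD n : (0 < g ^ n)%N by rewrite expn_gt0 ltnW.
have XD : (X < g ^ (8 * (u + X)))%N.
  apply: leq_trans (ltn_expl X g1) _; rewrite leq_exp2l //; lia.
rewrite (coprime_count_moebius g1 XD) -/A.
rewrite (big_cat_nat _ (n := g ^ (8 * u))) //=; last by rewrite leq_exp2l //; lia.
set S1 := \sum_(1 <= d < _) _; set S2 := \sum_(_ <= d < _) _.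
have hS2 : `|S2| <= C1 * g%:R ^+ 8 * N%:R ^+ 2 * q ^+ u.
  apply: le_trans (ler_norm_sum _ _ _) _.
  apply: (@le_trans _ _ (C1 * g%:R ^+ (2 * H) * q ^+ u)); last first.
    rewrite ler_wpM2r ?exprn_ge0 ?(ltW q0) // -mulrA ler_wpM2l //.
    rewrite mulnC exprM (_ : g%:R ^+ 8 * _ = (g%:R ^+ 4 * N%:R) ^+ 2); last first.
      by rewrite exprMn -exprM.
    by rewrite ler_pXn2r // nnegrE ?mulr_ge0 ?exprn_ge0 // ltW.
  apply: le_trans (HC1 X u X X0); apply: ler_sum => d _.
  rewrite normrM (ger0_norm (exprn_ge0 _ _)) // ler_piMl ?exprn_ge0 //.
  exact: norm_moebiusR.
have hS1 : `|S1 - N%:R ^+ 2 * moebius_sum R M (g ^ (8 * u))| <=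
    2 * c%:R * g%:R ^+ 4 * N%:R ^+ 2 * q ^+ u.
  have -> : S1 = \sum_(1 <= d < g ^ (8 * u) | coprime d M) (moebius d)%:~R * (A d)%:R ^+ 2.
    rewrite [RHS]big_mkcond /=; apply: eq_bigr => d _; case: ifPn => // dM.
    by rewrite /A pstar_mult_eq0 ?(ltnW g1) // expr0n mulr0.
  rewrite /moebius_sum mulr_sumr -sumrB.
  apply: le_trans (ler_norm_sum _ _ _) _.
  (* [A_d ^ 2 - (N / d) ^ 2] is the difference, at most [delta] in absolute value, times the sum, at
     most [2 * N]. Adding up fewer than [g ^ (8 * u)] such terms leaves [q ^ u]. *)
  pose delta := c%:R * g%:R ^+ H * q ^+ (9 * u).
  have delta0 : 0 <= delta by rewrite !mulr_ge0 ?exprn_ge0 // ltW.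
  have nd : 0 <= 2 * N%:R * delta by apply: mulr_ge0 => //; apply: mulr_ge0.
  apply: (@le_trans _ _ (\sum_(1 <= d < g ^ (8 * u)) (2 * N%:R * delta))); last first.
    rewrite big_const_nat iter_addr_0 -[leLHS]mulr_natl.
    apply: (@le_trans _ _ (g%:R ^+ (8 * u) * (2 * N%:R * delta))).
      by apply: ler_wpM2r => //; rewrite -natrX ler_nat leq_subr.
    rewrite /delta (_ : (9 * u = 8 * u + u)%N); last by lia.
    rewrite exprD {2}/q exprVn.
    have gu0 : g%:R ^+ (8 * u) != 0 :> R by rewrite expf_neq0 // gt_eqF.
    rewrite (_ : _ * _ = 2 * N%:R * c%:R * q ^+ u * g%:R ^+ H); last by field.
    rewrite (_ : 2 * c%:R * _ * _ * _ = 2 * N%:R * c%:R * q ^+ u * (g%:R ^+ 4 * N%:R)); last by ring.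
    by rewrite ler_wpM2l // !mulr_ge0 ?exprn_ge0 // ltW.
  rewrite big_mkcond /= big_nat [leRHS]big_nat; apply: ler_sum => d /andP[d0 dD].
  case: ifPn => dM //.
  have D0 : 0 < d%:R :> R by rewrite ltr0n.
  have dd : (0 < d < g ^ (8 * u))%N by rewrite d0.
  have [h1 h2] := Hu d dd dM.
  rewrite [N%:R ^+ 2 * _]mulrCA -mulrBr normrM.
  apply: le_trans (ler_piMl (normr_ge0 _) (norm_moebiusR R d)) _.
  have -> : (A d)%:R ^+ 2 - N%:R ^+ 2 * invsq R d =
     ((A d)%:R - N%:R / d%:R) * ((A d)%:R + N%:R / d%:R) by rewrite /invsq; field; lra.
  have Nd : N%:R / d%:R <= N%:R :> R.
    by rewrite ler_pdivrMr // ler_peMr // (ler_nat _ 1).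
  have Ad : (A d)%:R <= N%:R :> R by rewrite ler_nat pstar_mult_le1.
  rewrite normrM mulrC; apply: ler_pM => //.
    rewrite ger0_norm ?addr_ge0 ?divr_ge0 // mulr2n mulrDl !mul1r; exact: lerD.
  have gu : 0 < g%:R ^+ (9 * u) :> R by rewrite exprn_gt0.
  have pos : 0 < g%:R ^+ (9 * u) * d%:R :> R by rewrite mulr_gt0.
  rewrite -(ler_pM2l pos) -{1}(gtr0_norm pos) -normrM.
  have -> : g%:R ^+ (9 * u) * d%:R * ((A d)%:R - N%:R / d%:R) =
    g%:R ^+ (9 * u) * (d%:R * (A d)%:R) - g%:R ^+ (9 * u) * N%:R :> R by field; lra.
  have -> : g%:R ^+ (9 * u) * d%:R * delta = d%:R * c%:R * g%:R ^+ H.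
    by rewrite /delta /q exprVn; field; rewrite gt_eqF.
  move: h1 h2; rewrite -!(ler_nat R) !natrD !natrM !natrX => h1 h2.
  by rewrite ler_norml lerBrDr addrC lerBlDr lerBlDl h1 addrC; lra.
have hk : `|N%:R ^+ 2 * moebius_sum R M (g ^ (8 * u)) - kappa * N%:R ^+ 2| <=
    C0 * N%:R ^+ 2 * q ^+ u.
  rewrite [kappa * _]mulrC -mulrBr normrM (ger0_norm (exprn_ge0 _ _)) //.
  rewrite [leRHS](_ : _ = N%:R ^+ 2 * (C0 * q ^+ u)); last by ring.
  apply: ler_wpM2l; first exact: exprn_ge0.
  have := Hk _ (gD (4 * u)%N); rewrite -expnM (_ : (4 * u * 2 = 8 * u)%N); last by lia.
  move=> /le_trans; apply; rewrite ler_wpM2l // natrX -exprVn.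
  by rewrite ler_wiXn2l ?(ltW q0) //; lia.
have -> : S1 + S2 - kappa * N%:R ^+ 2 =
  (S1 - N%:R ^+ 2 * moebius_sum R M (g ^ (8 * u))) +
  (N%:R ^+ 2 * moebius_sum R M (g ^ (8 * u)) - kappa * N%:R ^+ 2) + S2 by ring.
have -> : (2 * c%:R * g%:R ^+ 4 + C0 + C1 * g%:R ^+ 8) * N%:R ^+ 2 * q ^+ u =
  2 * c%:R * g%:R ^+ 4 * N%:R ^+ 2 * q ^+ u + C0 * N%:R ^+ 2 * q ^+ u +
  C1 * g%:R ^+ 8 * N%:R ^+ 2 * q ^+ u by ring.
apply: le_trans (ler_normD _ _) _; apply: lerD => //.
by apply: le_trans (ler_normD _ _) _; apply: lerD.
Qed.

End Asymptotics.

(** * Palindromic digit strings and their enumeration by [pal] *)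

Section DigitStrings.
Local Open Scope nat_scope.

Lemma sum_digits_lt (g T : nat) (c : nat -> nat) : 1 < g ->
  (forall i, i < T -> c i < g) -> \sum_(0 <= i < T) c i * g ^ i < g ^ T.
Proof.
move=> g1; elim: T => [|T IH] cg; first by rewrite big_geq.
rewrite big_nat_recr //= expnS.
have h1 := IH (fun i iT => cg i (leqW iT)); have h2 := cg T (ltnSn T).
have : (c T).+1 * g ^ T <= g * g ^ T by rewrite leq_mul2r h2 orbT.
by rewrite mulSn; lia.
Qed.

Lemma digit_sum (g T j : nat) (c : nat -> nat) : 1 < g ->
  (forall i, i < T -> c i < g) -> j < T ->
  digit g (\sum_(0 <= i < T) c i * g ^ i) j = c j.
Proof.
move=> g1; elim: T => // T IH cg jT.
rewrite big_nat_recr //= addnC.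
have cg' i : i < T -> c i < g by move=> iT; apply: cg; apply: leqW.
have lt := sum_digits_lt g1 cg'.
have [jT'|Tj] := ltnP j T; first by rewrite digit_low // IH.
have -> : j = T + 0 by lia.
by rewrite digit_high // addn0 /digit expn0 divn1 modn_small ?cg.
Qed.

Lemma sum_palindromic (g h : nat) (d : nat -> nat) :
  (forall i, i <= 2 * h -> d i = d (2 * h - i)) ->
  \sum_(0 <= i < (2 * h).+1) d i * g ^ i =
  \sum_(0 <= i < h.+1) d (h + i) * weight g h i.
Proof.
move=> dd; rewrite (big_cat_nat _ (n := h)) //=; last by lia.
rewrite [in X in _ + X]big_ltn; last by lia.
rewrite [RHS]big_ltn // addn0 {1}/weight eqxx.
rewrite addnCA; congr (_ + _).
rewrite -[in X in _ + X](add1n h) big_addn (_ : (2 * h).+1 - h = h.+1); last by lia.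
rewrite big_nat_rev /= add0n !big_add1 /= -big_split /=.
rewrite big_nat [RHS]big_nat; apply: eq_bigr => i /andP[_ ih].
rewrite /weight /= mulnDr addnC (addnC i.+1 h); congr (_ + _ * _).
by rewrite (dd (h + i.+1)); [congr d; lia | lia].
Qed.

Lemma dvdn_odd_expn_add1 (g k : nat) : g.+1 %| g ^ (2 * k).+1 + 1.
Proof.
elim: k => [|k IH]; first by rewrite muln0 expn1 addn1.
have [->|g0] := posnP g; first exact: dvd1n.
have g2 : 0 < g ^ 2 by rewrite expn_gt0 g0.
have e : g ^ (2 * k.+1).+1 + 1 + (g ^ 2 - 1) = g ^ 2 * (g ^ (2 * k).+1 + 1).
  rewrite mulnDr muln1 -expnD (_ : 2 + (2 * k).+1 = (2 * k.+1).+1); last by lia.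
  by rewrite -addnA subnKC.
have d2 : g.+1 %| g ^ 2 - 1 by rewrite -{2}(exp1n 2) subn_sqr addn1 dvdn_mull.
by rewrite -(dvdn_addl _ d2) e dvdn_mull.
Qed.

(** Equal digits pair up two powers of [g] whose exponents differ by an odd number, and [g = -1]
    modulo [g + 1]. *)
Lemma dvdn_even_palindromic (g m : nat) (d : nat -> nat) :
  (forall i, i < 2 * m -> d i = d (2 * m - 1 - i)) ->
  g.+1 %| \sum_(0 <= i < 2 * m) d i * g ^ i.
Proof.
move=> dd; rewrite (big_cat_nat _ (n := m)) //=; last by lia.
rewrite -[X in _ + \sum_(X <= _ < _) _]add0n big_addn (_ : 2 * m - m = m); last by lia.
rewrite big_nat_rev /= add0n -big_split /= big_nat; apply: dvdn_sum => i /andP[_ im].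
rewrite (dd (m - i.+1)); last by lia.
have -> : 2 * m - 1 - (m - i.+1) = i + m by lia.
rewrite -mulnDr; apply: dvdn_mull.
have -> : i + m = (2 * i).+1 + (m - i.+1) by lia.
by rewrite expnD -{1}[g ^ (m - _)]mul1n -mulnDl addnC dvdn_mulr // dvdn_odd_expn_add1.
Qed.

Lemma pal_of_digits (g h : nat) (d : nat -> nat) : 1 < g ->
  (forall i, i <= 2 * h -> d i < g) -> d (2 * h) <> 0 ->
  (forall i, i <= 2 * h -> d i = d (2 * h - i)) ->
  exists2 a, g ^ h <= a < g ^ h.+1 &
    \sum_(0 <= i < (2 * h).+1) d i * g ^ i = pal g h a.
Proof.
move=> g1 dg dn dd; pose a := \sum_(0 <= i < h.+1) d (h + i) * g ^ i.
have cg i : i < h.+1 -> d (h + i) < g by move=> ih; apply: dg; lia.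
exists a.
  rewrite (sum_digits_lt g1 cg) andbT /a big_nat_recr //= addnn -mul2n.
  by apply: leq_trans (leq_addl _ _); rewrite leq_pmull //; lia.
rewrite sum_palindromic // /pal /block big_nat [RHS]big_nat.
by apply: eq_bigr => i /andP[_ ih]; rewrite /a digit_sum.
Qed.

Lemma digits_of_pal (g h a : nat) : 1 < g -> g ^ h <= a < g ^ h.+1 ->
  exists d : nat -> nat,
    [/\ forall i, d i < g, d (2 * h) <> 0,
      forall i, i <= 2 * h -> d i = d (2 * h - i)
    & pal g h a = \sum_(0 <= i < (2 * h).+1) d i * g ^ i].
Proof.
move=> g1 /andP[ha ah]; exists (fun i => digit g a (if i <= h then h - i else i - h)).
have dd i : i <= 2 * h -> digit g a (if i <= h then h - i else i - h) =
    digit g a (if 2 * h - i <= h then h - (2 * h - i) else 2 * h - i - h).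
  by move=> ih; congr digit; do 2 (case: leqP => ?); lia.
split=> // [i||].
- exact: digit_lt.
- have gh : 0 < g ^ h by rewrite expn_gt0 ltnW.
  have -> : (if 2 * h <= h then h - 2 * h else 2 * h - h) = h by case: leqP; lia.
  have q1 : 0 < a %/ g ^ h by rewrite divn_gt0.
  by rewrite /digit modn_small ?ltn_divLR // -?expnS //; lia.
rewrite (@sum_palindromic g h (fun i => digit g a (if i <= h then h - i else i - h))) //.
rewrite /pal /block big_nat [RHS]big_nat; apply: eq_bigr => i /andP[_ ih].
by congr (digit _ _ _ * _); case: leqP; lia.
Qed.

(** The size of the value, between [g ^ (2 * h)] and [g ^ (2 * h + 1)], determines [h]; then strict
    monotonicity applies. *)
Lemma pal_inj (g h h' a a' : nat) : 1 < g -> g ^ h <= a < g ^ h.+1 ->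
  g ^ h' <= a' < g ^ h'.+1 -> pal g h a = pal g h' a' -> h = h' /\ a = a'.
Proof.
move=> g1; have range k b : g ^ k <= b < g ^ k.+1 -> g ^ (2 * k) <= pal g k b < g ^ (2 * k).+1.
  move=> /andP[kb bk]; rewrite pal_ltX // andbT.
  have /andP[+ _] := pal_bounds g1 bk; apply: leq_trans.
  by rewrite mul2n -addnn expnD leq_mul2r kb orbT.
have le k k' b b' : g ^ k <= b < g ^ k.+1 -> g ^ k' <= b' < g ^ k'.+1 ->
    pal g k b = pal g k' b' -> k <= k'.
  move=> /range/andP[h1 _] /range/andP[_ h2] e; rewrite -e in h2.
  by have := leq_ltn_trans h1 h2; rewrite ltn_exp2l //; lia.
move=> ha ha' e.
have hh : h = h' by apply/eqP; rewrite eqn_leq (le _ _ _ _ ha ha' e) (le _ _ _ _ ha' ha).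
split=> //; rewrite -hh in ha' e.
case/andP: ha => _ ha; case/andP: ha' => _ ha'.
case: (ltngtP a a') => // lt.
  by have := pal_lt g1 ha' lt; rewrite e ltnn.
by have := pal_lt g1 ha lt; rewrite e ltnn.
Qed.

Lemma pstar_seq_uniq (g X : nat) : 1 < g -> uniq (pstar_seq g X).
Proof.
move=> g1; apply: filter_uniq; apply: allpairs_uniq_dep; rewrite ?iota_uniq //.
  by move=> h _; exact: iota_uniq.
move=> [h a] [h' a'] /allpairsPdep[k [b [_ hb [-> ->]]]] /allpairsPdep[k' [b' [_ hb' [-> ->]]]] /= e.
rewrite mem_index_iota in hb; rewrite mem_index_iota in hb'.
by have [<- <-] := pal_inj g1 hb hb' e.
Qed.

Lemma mem_pstar_seqP (g X n : nat) : 1 < g ->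
  n \in pstar_seq g X <->
  [/\ 1 <= n, n <= X,
      (exists L d, [/\ 1 <= L, forall i, i < L -> d i < g, d (L - 1) <> 0
                     & n = \sum_(0 <= i < L) d i * g ^ i] /\
                   forall i, i <= L - 1 -> d i = d (L - 1 - i))
    & gcdn n (g ^ 3 - g) = 1].
Proof.
move=> g1; have g0 : 0 < g by apply: ltnW.
split=> [nP|[n0 nX [L [d [[L0 dg dn nE] dd]]] cn]].
  have /andP[n0 nX] := mem_pstar_seq g1 nP; split=> //; last first.
    by move: nP; rewrite mem_filter => /andP[/andP[_ /eqP]].
  move: nP; rewrite mem_filter => /andP[_ /allpairsPdep[h [a [_ ha ->]]]].
  rewrite mem_index_iota in ha.
  have [d [dg dn dd E]] := digits_of_pal g1 ha.
  by exists (2 * h).+1, d; rewrite subn1 /=; split.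
rewrite mem_filter nX /coprime cn eqxx 2!andTb; apply/allpairsPdep.
have [Lodd|Leven] := boolP (odd L); last first.
  have LE : L = 2 * L./2 by rewrite mul2n even_halfK.
  have gn : g.+1 %| n.
    rewrite nE LE; apply: dvdn_even_palindromic => i iL.
    by rewrite -LE in iL *; apply: dd; lia.
  have gM : g.+1 %| g ^ 3 - g.
    rewrite (_ : g ^ 3 - g = g * (g ^ 2 - 1)).
      by rewrite -{2}(exp1n 2) subn_sqr addn1 !dvdn_mull.
    by rewrite mulnBr muln1 -expnS.
  have : g.+1 %| gcdn n (g ^ 3 - g) by rewrite dvdn_gcd gn.
  by rewrite cn dvdn1; lia.
pose h := L./2; have LE : L = (2 * h).+1.
  by rewrite /h -[L in LHS]odd_double_half Lodd mul2n add1n.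
rewrite LE subn1 /= in dg dn dd nE.
have [a ha aE] := pal_of_digits g1 dg dn dd.
exists h, a; rewrite mem_index_iota ha nE; split=> //.
rewrite mem_iota add0n /= ltnS; apply: trunc_log_max.
  by rewrite -(exp1n 2) ltn_exp2r.
rewrite -expnM; apply: leq_trans nX; rewrite nE aE.
case/andP: ha => ha ah; have /andP[+ _] := pal_bounds g1 ah; apply: leq_trans.
by rewrite mul2n -addnn expnD leq_mul2r ha orbT.
Qed.

End DigitStrings.

(** * Transfer to real [x], to [zeta] and to the sets of the statement *)

Section Link.
Variable R : realType.

Lemma zeta2_approx (D : nat) : (0 < D)%N ->
  `|\sum_(1 <= k < D) invsq R k - zeta (2 : R)| <= 2 / D%:R.
Proof.
move=> D0; set u := fun k : nat => (k.+1%:R `^ 2 : R)^-1.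
have uE k : u k = invsq R k.+1 by rewrite /u powR_mulrn.
have SE n : series u n = \sum_(1 <= k < n.+1) invsq R k.
  by rewrite /series /= big_add1 /=; apply: eq_bigr => k _; rewrite uE.
have mono : nondecreasing_seq (series u).
  apply/nondecreasing_seqP => n; rewrite /series /= big_nat_recr //= lerDl uE.
  exact: invsq_ge0.
have bnd n : series u n <= 2 by rewrite SE (sum_le_invsq R xpredT).
have cv : cvgn (series u).
  apply: nondecreasing_is_cvgn => //; exists 2 => _ [n _ <-]; exact: bnd.
have lo n : series u n <= zeta (2 : R) by exact: nondecreasing_cvgn_le.
have hi : zeta (2 : R) <= series u D.-1 + 2 / D%:R.
  apply: limr_le => //; exists D => // n /= Dn.
  rewrite !SE prednK // (big_cat_nat _ (n := D)) //=; last exact: leqW.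
  by rewrite lerD2l sum_invsq_tail.
have := lo D.-1; move: hi; rewrite SE prednK // => h1 h2.
by rewrite ler_norml; apply/andP; split; lra.
Qed.

(** The approximation with [D = 3] suffices, as [1 + 1 / 4 > 2 / 3]. *)
Lemma zeta2_gt0 : 0 < zeta (2 : R).
Proof.
have := @zeta2_approx 3 isT.
rewrite big_nat_recr //= big_nat1 /invsq expr1n invr1 => /ler_normlP[_].
by have : (2%:R ^+ 2)^-1 = 1 / 4 :> R by [field]; lra.
Qed.

Lemma PstarE (g : nat) (x : R) : (1 < g)%N -> 1 <= x ->
  Pstar g x = [set` pstar_seq g (Num.truncn x)].
Proof.
move=> g1 x1; have x0 : 0 <= x by apply: le_trans x1.
apply/seteqP; split=> n /=.
  move=> [n0 nx [L [d [dn dd]]] cn]; apply/(mem_pstar_seqP _ _ g1).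
  by split=> //; [rewrite truncn_ge_nat | exists L, d].
move=> /(mem_pstar_seqP _ _ g1)[n0 nx [L [d [dn dd]]] cn].
by split=> //; [rewrite -truncn_ge_nat | exists L, d].
Qed.

Lemma card_Pstar (g : nat) (x : R) : (1 < g)%N -> 1 <= x ->
  #|` fset_set (Pstar g x)| = pstar_mult g (Num.truncn x) 1.
Proof.
move=> g1 x1; rewrite /pstar_mult; under eq_bigr => n _ do rewrite dvd1n.
rewrite sum1_size; apply: perm_size; apply: uniq_perm.
- exact: fset_uniq.
- exact: pstar_seq_uniq.
move=> n; rewrite in_fset_set; last exact: finite_Pstar.
by rewrite PstarE // mem_setE.
Qed.

Lemma sum_coprime_pairs (g : nat) (x : R) : (1 < g)%N -> 1 <= x ->
  \sum_(mn \in coprime_pairs g x) (1 : R) = (coprime_count g (Num.truncn x))%:R.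
Proof.
move=> g1 x1; set s := pstar_seq g (Num.truncn x).
pose s2 := [seq mn <- [seq (m, n) | m <- s, n <- s] | coprime mn.1 mn.2].
have us := pstar_seq_uniq (Num.truncn x) g1.
have -> : coprime_pairs g x = [set` s2].
  rewrite /coprime_pairs PstarE //; apply/seteqP; split=> -[m n] /=.
    move=> [ms ns cmn]; rewrite mem_filter /= /coprime cmn eqxx /=.
    by apply/allpairsP; exists (m, n).
  rewrite mem_filter => /andP[/eqP /= cmn /allpairsP[[m' n'] /= [ms ns [em en]]]].
  by rewrite em en in cmn *.
rewrite -fsbig_seq; last first.
  by rewrite filter_uniq // allpairs_uniq // => -[a b] [c d] _ _ [-> ->].
rewrite /s2 big_filter big_mkcond big_allpairs /coprime_count natr_sum.
apply: eq_bigr => m _; rewrite natr_sum; apply: eq_bigr => n _ /=.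
by case: coprime.
Qed.

(** [x < g ^ (2 * H.+1)] and [H < B * u.+1 ^ 2] give [ln x <= 2 * B * ln g * u.+1 ^ 2], so
    [sqrt (ln x)] is at most a constant times [u + 1]. The factor [g] on the right absorbs the step
    from [u] to [u + 1]. *)
Lemma sqrt_ln_decay (g B : nat) : (1 < g)%N -> (0 < B)%N ->
  exists2 c : R, 0 < c & forall (x : R) u, 1 <= x ->
    (half_len g (Num.truncn x) < B * u.+1 ^ 2)%N ->
    g%:R^-1 ^+ u <= g%:R * expR (- c * Num.sqrt (ln x)).
Proof.
move=> g1 B0; have G0 : 0 < g%:R :> R by rewrite ltr0n ltnW.
have l0 : 0 < ln (g%:R : R) by rewrite ln_gt0 // (ltr_nat _ 1).
set l := ln _ in l0.
have lB : 0 < 2 * B%:R * l by rewrite !mulr_gt0 // ltr0n.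
set S := Num.sqrt (2 * B%:R * l); have S0 : 0 < S by rewrite sqrtr_gt0.
exists (l / S) => [|x u x1 Hu]; first by rewrite divr_gt0.
have X0 : (0 < Num.truncn x)%N by rewrite truncn_gt0.
have /andP[_ XH] := half_len_bounds g1 X0.
set H := half_len g _ in Hu XH.
have x0 : 0 < x by apply: lt_le_trans x1.
have xg : x <= g%:R ^+ (2 * H.+1).
  rewrite -natrX; apply: ltW; apply: lt_le_trans (truncnS_gt x) _.
  by rewrite ler_nat.
have lx : ln x <= (u.+1%:R) ^+ 2 * (2 * B%:R * l).
  apply: (@le_trans _ _ (ln (g%:R ^+ (2 * H.+1)))).
    by rewrite ler_ln ?posrE ?exprn_gt0.
  rewrite lnXn // -/l -[leLHS]mulr_natl.
  rewrite [leRHS](_ : _ = u.+1%:R ^+ 2 * (2 * B%:R) * l); last by ring.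
  apply: ler_wpM2r; first exact: ltW.
  rewrite -natrX -!natrM ler_nat; nia.
have sx : Num.sqrt (ln x) <= u.+1%:R * S.
  apply: le_trans (ler_wsqrtr lx) _.
  by rewrite sqrtrM ?exprn_ge0 // sqrtr_sqr ger0_norm.
have qE : g%:R^-1 = expR (- l) :> R by rewrite expRN lnK ?posrE.
have gE : g%:R = expR l :> R by rewrite lnK ?posrE.
rewrite qE {1}gE -expRM_natl -expRD ler_expR.
have h : l / S * Num.sqrt (ln x) <= u.+1%:R * l.
  rewrite mulrAC ler_pdivrMr // [leRHS](_ : _ = l * (u.+1%:R * S)); last by ring.
  by apply: ler_wpM2l => //; apply: ltW.
move: h; rewrite -[u.+1%:R]natr1 mulrDl mul1r mulrN mulNr; lra.
Qed.

End Link.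

Theorem theorem1p2 (R : realType) (g : nat) (hg : (2 <= g)%N) :
  exists c C : R, 0 < c /\ 0 < C /\
    exists E : R -> R, forall x : R, 1 <= x ->
      \sum_(mn \in coprime_pairs g x) (1 : R)
        = (zeta (2 : R))^-1
          * (\prod_(p <- primes (g ^ 3 - g)) (1 - (p%:R ^+ 2)^-1)^-1)
          * (#|` fset_set (Pstar g x) |%:R) ^+ 2
          * (1 + E x)
      /\ `|E x| <= C * expR (- c * Num.sqrt (ln x)).
Proof.
set kappa := (zeta (2 : R))^-1 * _.
have M0 : (0 < g ^ 3 - g)%N by rewrite subn_gt0 -{1}(expn1 g) ltn_exp2l.
have [C0 C00 HC0] := moebius_sum_limit M0 (zeta2_gt0 R) (@zeta2_approx R).
have k0 : 0 < kappa.
  rewrite /kappa mulr_gt0 ?invr_gt0 ?zeta2_gt0 // big_seq.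
  apply: prodr_gt0 => p; rewrite mem_primes => /and3P[pp _ _].
  have p1 : 1 < p%:R :> R by rewrite (ltr_nat _ 1) prime_gt1.
  by rewrite invr_gt0 subr_gt0 invf_lt1 ?exprn_gt0 ?exprn_egt1 //; lra.
have [B [C [B0 [CC HC]]]] := coprime_count_asymptotics hg C00 HC0.
have [c c0 Hc] := sqrt_ln_decay R hg B0.
have G0 : 0 < g%:R :> R by rewrite ltr0n ltnW.
(* The summand 1 keeps the constant positive even if [C = 0]. *)
exists c, (C / kappa * g%:R + 1); split=> //; split.
  by rewrite ltr_wpDl // mulr_ge0 ?(ltW G0) // divr_ge0 // ltW.
pose N (x : R) : R := (pstar_mult g (Num.truncn x) 1)%:R.
pose T (x : R) : R := (coprime_count g (Num.truncn x))%:R.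
(* The required identity forces this value, because [N x > 0] for [x >= 1]. *)
exists (fun x => T x / (kappa * N x ^+ 2) - 1) => x x1.
have X0 : (0 < Num.truncn x)%N by rewrite truncn_gt0.
have [u uH] := HC _ X0; rewrite -/kappa -/(N x) -/(T x) => main.
have N0 : 0 < N x.
  rewrite /N ltr0n; have := pstar_mult1_ge hg X0.
  have : (0 < g ^ half_len g (Num.truncn x))%N by rewrite expn_gt0 ltnW.
  by case: (pstar_mult _ _ _) => //; rewrite muln0; lia.
rewrite sum_coprime_pairs // card_Pstar // -/(N x) -/(T x); split.
  by field; rewrite !gt_eqF.
have kN : 0 < kappa * N x ^+ 2 by rewrite mulr_gt0 // exprn_gt0.
have -> : T x / (kappa * N x ^+ 2) - 1 = (T x - kappa * N x ^+ 2) / (kappa * N x ^+ 2).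
  by field; rewrite !gt_eqF.
rewrite normrM normfV (gtr0_norm kN) ler_pdivrMr //.
apply: le_trans main _.
have h := Hc x u x1 uH; set e := expR _ in h *.
have e0 : 0 <= e by apply: expR_ge0.
apply: (@le_trans _ _ (C * N x ^+ 2 * (g%:R * e))).
  by rewrite ler_wpM2l // mulr_ge0 // exprn_ge0 // ltW.
have -> : (C / kappa * g%:R + 1) * e * (kappa * N x ^+ 2) =
   C * N x ^+ 2 * (g%:R * e) + e * (kappa * N x ^+ 2).
  by field; rewrite gt_eqF.
by rewrite lerDl mulr_ge0 // ltW.
Qed.
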